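(* Let $X$ be an infinite-dimensional separable Banach space, and let $\mathcal{L}(X)$ be the set of all bounded linear operators from $X$ to itself. Then the set of all hypercyclic operators $T\in\mathcal{L}(X)$ having a residual set of absolutely mean irregular vectors is dense in $\mathcal{L}(X)$ with respect to the strong operator topology.
   Context: $T^n$ denotes the $n$-fold composition of $T$. A vector $x\in X$ is a hypercyclic vector for $T$ if its orbit $\{T^nx : n\ge 0\}$ is dense in $X$; $T$ is hypercyclic if it has some hypercyclic vector. A vector $x\in X$ is absolutely mean irregular for $T$ if $\liminf_{n\to\infty}\frac1n\sum_{i=1}^n\Vert T^ix\Vert=0$ and $\limsup_{n\to\infty}\frac1n\sum_{i=1}^n\Vert T^ix\Vert=\infty$. A subset of $X$ is residual if it contains a dense $G_\delta$ subset of $X$. The strong operator topology on $\mathcal{L}(X)$ is the topology in which each $T\in\mathcal{L}(X)$ has a neighborhood basis consisting of the sets $\{S\in\mathcal{L}(X): \Vert Sx_i-Tx_i\Vert<\varepsilon,\ i=1,\dots,n\}$, where $x_1,\dots,x_n\in X$ and $\varepsilon>0$. *)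

(* Defs.v *)
From HB Require Import structures.
From mathcomp Require Import all_boot all_order all_algebra.
From mathcomp Require Import all_classical all_reals all_analysis.
From mathcomp Require Import borel_hierarchy complex.

Set Implicit Arguments.
Unset Strict Implicit.
Unset Printing Implicit Defensive.

Import Order.TTheory GRing.Theory Num.Theory.
Import numFieldNormedType.Exports.

Local Open Scope classical_set_scope.
Local Open Scope ring_scope.

Definition separable (T : topologicalType) : Prop :=
  exists2 D : set T, countable D & dense D.

Definition residual (T : topologicalType) (A : set T) : Prop :=
  exists G : set T, [/\ Gdelta G, dense G & G `<=` A].

Definition infinite_dimensional (K : numFieldType) (X : lmodType K) : Prop :=
  ~ exists (n : nat) (v : 'I_n -> X),
      forall x : X, exists c : 'I_n -> K, x = \sum_(i < n) c i *: v i.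

Record bounded_operator (K : numFieldType) (X : normedModType K) :=
  BoundedOperator {
    operator_fun :> {linear X -> X};
    operator_bounded : exists M : K, forall x, `|operator_fun x| <= M * `|x| }.

Section StrongOperatorTopology.
Variables (K : numFieldType) (X : normedModType K).
Local Notation L := (bounded_operator X).

HB.instance Definition _ := gen_eqMixin L.
HB.instance Definition _ := gen_choiceMixin L.

Definition sot_basic (T : L) (p : seq X * K) : set L :=
  [set S : L | forall x, x \in p.1 -> `|S x - T x| < p.2].

Definition sot_nbhs (T : L) : set_system L :=
  filter_from [set p : seq X * K | 0 < p.2] (sot_basic T).

HB.instance Definition _ := hasNbhs.Build L sot_nbhs.

Lemma sot_nbhs_filter (T : L) : ProperFilter (sot_nbhs T).
Proof.
apply: filter_from_proper; last first.
  by move=> [s e] /= e0; exists T => x _ /=; rewrite subrr normr0.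
apply: filter_from_filter; first by exists ([::], 1) => /=.
move=> [s e] [t d] /= e0 d0; exists (s ++ t, Num.min e d) => /=.
  by case: (real_ltP (gtr0_real e0) (gtr0_real d0)).
move=> S HS; split=> x xs /=.
  have := HS x; rewrite mem_cat xs => /(_ isT) /lt_le_trans; apply => /=.
  by case: (real_ltP (gtr0_real e0) (gtr0_real d0)).
have := HS x; rewrite mem_cat xs orbT => /(_ isT) /lt_le_trans; apply => /=.
by case: (real_ltP (gtr0_real e0) (gtr0_real d0)) => // /ltW.
Qed.

Lemma sot_nbhs_singleton (T : L) (A : set L) : sot_nbhs T A -> A T.
Proof.
by move=> [[s e] /= e0]; apply => x _ /=; rewrite subrr normr0.
Qed.

Lemma sot_nbhs_nbhs (T : L) (A : set L) :
  sot_nbhs T A -> sot_nbhs T (sot_nbhs^~ A).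
Proof.
move=> [[s e] /= e0 sA]; exists (s, e / 2) => /=; first by rewrite divr_gt0.
move=> S HS; exists (s, e / 2) => /=; first by rewrite divr_gt0.
move=> U HU; apply: sA => x xs /=.
rewrite -(subrK (S x) (U x)) -addrA (le_lt_trans (ler_normD _ _))//.
by rewrite [ltRHS]splitr ltrD// ?HU ?HS.
Qed.

(* From here on [bounded_operator X] carries the strong operator topology. *)
HB.instance Definition _ := Nbhs_isNbhsTopological.Build L
  sot_nbhs_filter sot_nbhs_singleton sot_nbhs_nbhs.

End StrongOperatorTopology.

Section Dynamics.
Variables (K : numFieldType) (X : normedModType K).
Implicit Types (T : bounded_operator X) (x : X).

Definition orbit_set T x : set X := range (fun n : nat => iter n T x).

Definition hypercyclic_vector T x : Prop := dense (orbit_set T x).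

Definition hypercyclic T : Prop := exists x, hypercyclic_vector T x.

(* The norm of a [normedModType K] takes its values in K. The map [re] turns
   it into an element of R, where limits inferior and superior make sense:
   it is the identity for K = R and the real part for K = R[i]. *)
Variables (R : realType) (re : K -> R).

Definition orbit_mean T x (n : nat) : R :=
  n%:R^-1 * \sum_(1 <= i < n.+1) re `|iter i T x|.

Definition absolutely_mean_irregular T x : Prop :=
  limn_einf (EFin \o orbit_mean T x) = 0%E /\
  limn_esup (EFin \o orbit_mean T x) = +oo%E.

End Dynamics.

(* Main.v *)
(* The operators built here act as the translation p(t) |-> p(t + 1) on the span of
   vectors b_n standing for t^n/n!. With functionals f_n biorthogonal to the b_n they
   are T x = x + sum_n f_n(x) v_n, where v_n = sum_(j < n) b_j/(n - j)!, and are bounded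
   once sum_n |f_n| |v_n| < oo. Finitely many b_n can be prescribed, whence the density.
   As T^i b_1 = b_1 + i b_0, orbit means are generically unbounded, so the point is that
   vectors with small orbit means are dense. To see this t^m/m! is perturbed into
   t^m F(t)/m!, where F(t) = T_d(x_0 - h t)/T_d(x_0) is a rescaled Chebyshev polynomial,
   close to 1 near 0 and tiny on most of [0, N]. This is a small perturbation provided
   that |b_n| grows along a block of length d at most like (k!)^2 theta^k with theta
   logarithmic in d, and for such growth sum_n |f_n| |v_n| still converges if
   |f_n| |b_n| <= 3 along the block. Mazur's construction of basic sequences gives
   arbitrarily long blocks of this kind; the vectors needed to make the span dense, for
   which |f_n| |b_n| is uncontrolled, are inserted between the blocks. The reflected
   polynomials, in which t is replaced by N - t, give topological transitivity. *)

Require Import Defs.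
From HB Require Import structures.
From mathcomp Require Import all_boot all_order all_algebra.
From mathcomp Require Import all_classical all_reals all_analysis.
From mathcomp Require Import borel_hierarchy complex.
From mathcomp Require Import zify ring lra.

Set Implicit Arguments.
Unset Strict Implicit.
Unset Printing Implicit Defensive.

Import Order.TTheory GRing.Theory Num.Theory.
Import numFieldNormedType.Exports.

Local Open Scope classical_set_scope.
Local Open Scope ring_scope.

(** * Chebyshev polynomials *)

(** Boundedness and smallness pull in opposite directions. The terms |f_n| |v_n| become summable
    over a block because |b_n| grows factorially, but then a vector is small only if all derivatives
    of its polynomial are. Markov's inequality says what to expect: a polynomial of degree d bounded
    by 1 on an interval of length L has k-th derivative at most (2 d^2/L)^k/k!, and against weights
    like k! theta^k this asks for d^2 theta/L small, hence for intervals of length about d^2 theta.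
    Chebyshev polynomials fit: at distance about 4^(-Q) outside [-1, 1] they are already at least
    2^(Q^2)/2 when d = Q^2 2^Q. The square in 2^(Q^2) pays for the factor t^m, which for t up to N
    and m < s costs about 4^(Q s), where s is fixed before Q. A polynomial and its reflection
    exchange the times 0 and N, so both halves of the transitivity argument share the same N. *)

Lemma derivn_XM (R : nzRingType) (p : {poly R}) k : ('X * p)^`(k) = 'X * p^`(k) + p^`(k.-1) *+ k.
Proof.
case: k => [|j]; first by rewrite mulr0n addr0.
elim: j => [|j IH]; first by rewrite !derivn1 derivM derivX mul1r addrC derivn0.
by rewrite derivnS IH derivD derivM derivX mul1r derivMn -!derivnS addrAC -mulrS addrC.
Qed.

Section Chebyshev.
Variable R : realFieldType.
Implicit Types (n k : nat) (x : R).

(** The pair is (T_n, U_(n-1)), the Chebyshev polynomials of the first and second kind. The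
    recursion is multiplication by x + sqrt(x^2 - 1), written in the basis 1, sqrt(x^2 - 1); this is
    the source of the addition formula and of the Pell identity. *)
Fixpoint cheb n : {poly R} * {poly R} :=
  if n is m.+1 then
    ('X * (cheb m).1 + ('X^2 - 1) * (cheb m).2, 'X * (cheb m).2 + (cheb m).1)
  else (1, 0).

Definition chebT n := (cheb n).1.
Definition chebW n := (cheb n).2.

Lemma chebTS n : chebT n.+1 = 'X * chebT n + ('X^2 - 1) * chebW n.
Proof. by []. Qed.

Lemma chebWS n : chebW n.+1 = 'X * chebW n + chebT n.
Proof. by []. Qed.

Lemma chebTSS n : chebT n.+2 = 'X * chebT n.+1 *+ 2 - chebT n.
Proof. by rewrite chebTS chebWS; rewrite !chebTS; ring. Qed.

Lemma chebWSS n : chebW n.+2 = 'X * chebW n.+1 *+ 2 - chebW n.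
Proof. by rewrite chebWS chebTS !chebWS; ring. Qed.

Lemma chebTD a b : chebT (a + b) = chebT a * chebT b + ('X^2 - 1) * (chebW a * chebW b).
Proof.
suff [] : chebT (a + b) = chebT a * chebT b + ('X^2 - 1) * (chebW a * chebW b) /\
  chebW (a + b) = chebT a * chebW b + chebW a * chebT b by [].
elim: a => [|a [IHT IHW]]; first by rewrite /chebT /chebW/= add0n !(mul1r, mul0r, mulr0, addr0).
by rewrite addSn !chebTS !chebWS IHT IHW; split; ring.
Qed.

Lemma cheb_pell n : chebT n ^+ 2 - ('X^2 - 1) * chebW n ^+ 2 = 1.
Proof.
elim: n => [|n IH]; first by rewrite /chebT /chebW/=; ring.
by rewrite chebTS chebWS -[RHS]IH; ring.
Qed.

Lemma deriv_chebT n : (chebT n)^`() = chebW n *+ n.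
Proof.
suff [] : (chebT n)^`() = chebW n *+ n /\
   ('X^2 - 1) * (chebW n)^`() = chebT n *+ n - 'X * chebW n by [].
elim: n => [|n [IHT IHW]].
  by rewrite /chebT /chebW/= derivC deriv0; split; ring.
have dX2 : ('X^2 - 1 : {poly R})^`() = 'X *+ 2.
  by rewrite derivB derivXn derivC subr0 expr1.
split.
  by rewrite chebTS chebWS derivD !derivM derivX dX2 IHT IHW; ring.
rewrite chebWS chebTS derivD !derivM derivX mul1r mulrDr IHT mulrDr [X in _ + X + _]mulrCA IHW.
by ring.
Qed.

Lemma size_chebT n : (size (chebT n) <= n.+1)%N.
Proof.
suff [] : (size (chebT n) <= n.+1)%N /\ (size (chebW n) <= n)%N by [].
elim: n => [|n [IHT IHW]]; first by rewrite /chebT /chebW/= size_poly1 size_poly0.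
rewrite chebTS chebWS; split; apply: (leq_trans (size_polyD _ _)); rewrite geq_max; apply/andP;
  split.
- by apply: (leq_trans (size_polyMleq _ _)); rewrite size_polyX.
- apply: (leq_trans (size_polyMleq _ _)).
  have := size_XnsubC (1 : R) (isT : 0 < 2)%N; rewrite polyC1 => ->.
  by rewrite addSn/= !addSn add0n !ltnS.
- by apply: (leq_trans (size_polyMleq _ _)); rewrite size_polyX.
- exact: IHT.
Qed.

Local Notation T n x := (chebT n).[x].
Local Notation W n x := (chebW n).[x].

Lemma chebT_eq x n : T n.+1 x = x * T n x + (x ^+ 2 - 1) * W n x.
Proof. by rewrite chebTS !hornerE. Qed.

Lemma chebW_eq x n : W n.+1 x = x * W n x + T n x.
Proof. by rewrite chebWS !hornerE. Qed.

Lemma chebT_eq2 x n : T n.+2 x = 2 * x * T n.+1 x - T n x.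
Proof. by rewrite chebT_eq chebW_eq chebT_eq; ring. Qed.

Lemma chebT0 x : T 0 x = 1.
Proof. by rewrite hornerE. Qed.

Lemma chebW0 x : W 0 x = 0.
Proof. by rewrite hornerE. Qed.

Lemma chebT_le1 n x : `|x| <= 1 -> `|T n x| <= 1.
Proof.
move=> x1; have := congr1 (horner^~ x) (cheb_pell n).
rewrite !(hornerD, hornerN, hornerM, horner_exp, hornerX, hornerC) => pell.
rewrite -(ler_pXn2r (_ : 0 < 2)%N)// ?nnegrE// expr1n real_normK ?num_real//.
have x2 : 0 <= 1 - x ^+ 2.
  by rewrite subr_ge0 -[x ^+ 2]real_normK ?num_real// exprn_ile1.
have := mulr_ge0 x2 (sqr_ge0 (W n x)); lra.
Qed.

Lemma chebW_len n x : `|x| <= 1 -> `|W n x| <= n%:R.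
Proof.
move=> x1; elim: n => [|n IH]; first by rewrite chebW0 normr0.
rewrite chebW_eq -natr1 (le_trans (ler_normD _ _))// lerD ?chebT_le1// normrM.
by rewrite (le_trans _ IH)// ler_piMl.
Qed.

Lemma chebTW_ge0 n x : 1 <= x -> 1 <= T n x /\ 0 <= W n x.
Proof.
move=> x1; elim: n => [|n [IHT IHW]]; first by rewrite chebT0 chebW0.
have x2 : 0 <= x ^+ 2 - 1 by nra.
have := mulr_ge0 x2 IHW; rewrite chebT_eq chebW_eq; split; nra.
Qed.

Lemma chebT_mono x : 1 <= x -> {homo (fun n => T n x) : m n / (m <= n)%N >-> m <= n}.
Proof.
move=> x1; apply: homo_leq; [by move=> ? | exact: le_trans|] => n.
have [IHT IHW] := chebTW_ge0 n x1.
have x2 : 0 <= x ^+ 2 - 1 by nra.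
by have := mulr_ge0 x2 IHW; rewrite chebT_eq; nra.
Qed.

Lemma chebT_incr n x y : 1 <= x -> x <= y -> T n x <= T n y.
Proof.
move=> x1 xy; suff [] : T n x <= T n y /\ W n x <= W n y by [].
elim: n => [|n [IHT IHW]]; first by rewrite !chebT0 !chebW0.
have [? ?] := chebTW_ge0 n x1.
rewrite !chebT_eq !chebW_eq; split; last by apply: lerD => //; apply: ler_pM => //; lra.
by apply: lerD; apply: ler_pM => //; nra.
Qed.

(** For x >= 1 this replaces the bound [chebW_len] on [-1, 1]: it lets the majorant T_n(x) pass
    through Green's formula in [derivn_chebT_bound]. *)
Lemma chebWT_le l j x : 1 <= x -> W l x * T j x <= l%:R * T (l + j) x.
Proof.
move=> x1; elim: l => [|l IH]; first by rewrite chebW0 !mul0r.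
have [Tlj Wlj] := chebTW_ge0 (l + j) x1.
have [Wl Wj] : 0 <= W l x /\ 0 <= W j x by split; have [] := chebTW_ge0 l x1;
  have [] := chebTW_ge0 j x1.
have E1 : x * T (l + j) x <= T (l.+1 + j) x.
  by rewrite addSn chebT_eq lerDl; apply: mulr_ge0 => //; nra.
have E2 : T l x * T j x <= T (l.+1 + j) x.
  apply: le_trans (_ : T (l + j) x <= _); last by apply: chebT_mono => //; rewrite addSn.
  rewrite chebTD !(hornerD, hornerN, hornerM, horner_exp, hornerX, hornerC) lerDl;
    apply: mulr_ge0; [nra|exact: mulr_ge0].
rewrite chebW_eq mulrDl -mulrA -natr1 mulrDl mul1r; apply: lerD => //.
have x0 : 0 <= x by lra.
by apply: le_trans (ler_wpM2l x0 IH) _; rewrite mulrCA; apply: ler_wpM2l.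
Qed.

(** Discrete form of (a^(q+2))'' = (q+2)(q+1) a^q. The sum and the difference of the powers of a + 1
    and a - 1 satisfy coupled recurrences, so both are bounded below in one induction. *)
Lemma second_difference_ge (q : nat) (a : R) : 1 <= a ->
  2 * a ^+ q.+2 + (q.+2 * q.+1)%:R * a ^+ q <= (a + 1) ^+ q.+2 + (a - 1) ^+ q.+2.
Proof.
move=> a1; suff [] : 2 * a ^+ q.+2 + (q.+2 * q.+1)%:R * a ^+ q <= (a + 1) ^+ q.+2 + (a - 1) ^+
  q.+2 /\
  2 * q.+2%:R * a ^+ q.+1 <= (a + 1) ^+ q.+2 - (a - 1) ^+ q.+2 by [].
elim: q => [|q [IHA IHB]].
  by rewrite expr0 expr1; split; rewrite !expr2 ?natrM; nra.
have aq : 0 <= a ^+ q by apply: exprn_ge0; lra.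
have aq1 : 0 <= a ^+ q.+1 by apply: exprn_ge0; lra.
set A := _ + (a - 1) ^+ q.+2 in IHA; set B := _ - (a - 1) ^+ q.+2 in IHB.
have -> : (a + 1) ^+ q.+3 + (a - 1) ^+ q.+3 = a * A + B.
  by rewrite ![_ ^+ q.+3]exprS /A /B; ring.
have -> : (a + 1) ^+ q.+3 - (a - 1) ^+ q.+3 = a * B + A.
  by rewrite ![_ ^+ q.+3]exprS /A /B; ring.
have a0 : 0 <= a by lra.
have HA := ler_wpM2l a0 IHA; have HB := ler_wpM2l a0 IHB.
split.
  apply: le_trans (lerD HA IHB).
  rewrite le_eqVlt; apply/orP; left; apply/eqP.
  by rewrite !natrM -!natr1 !exprS; ring.
apply: le_trans (lerD HB IHA).
rewrite -subr_ge0.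
have -> : a * (2 * q.+2%:R * a ^+ q.+1) + (2 * a ^+ q.+2 + (q.+2 * q.+1)%:R * a ^+ q)
  - 2 * q.+3%:R * a ^+ q.+2 = (q.+2 * q.+1)%:R * a ^+ q.
  by rewrite -!natr1 !exprS; ring.
by rewrite mulr_ge0.
Qed.

(** The weights n - j make this a double sum of j^q, and the second difference of n^(q+2) dominates
    (q+2)(q+1) n^q. *)
Lemma sum_weighted_powers (q n : nat) : (0 < q)%N ->
  q.+2%:R * q.+1%:R * \sum_(j < n) (n - j)%:R * j%:R ^+ q <= n%:R ^+ q.+2 :> R.
Proof.
move=> q0; set c : R := q.+2%:R * q.+1%:R.
have P m : c * \sum_(j < m.+1) j%:R ^+ q <= m.+1%:R ^+ q.+2 - m%:R ^+ q.+2.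
  elim: m => [|m IH].
    by rewrite big_ord_recr big_ord0/= expr0n gtn_eqF// addr0 mulr0 expr1n expr0n subr0.
  rewrite big_ord_recr mulrDr/= -lerBrDr (le_trans IH)//.
  have m1 : 1 <= m.+1%:R :> R by rewrite ler1n.
  have := second_difference_ge q m1.
  rewrite natrM -/c -[m.+2%:R]natr1 -[X in _ + (X - 1) ^+ _]natr1 addrK; lra.
have S m : \sum_(j < m.+1) (m.+1 - j)%:R * j%:R ^+ q =
   \sum_(j < m) (m - j)%:R * j%:R ^+ q + \sum_(j < m.+1) j%:R ^+ q :> R.
  rewrite big_ord_recr [X in _ + X]big_ord_recr/= addrA subSnn mul1r; congr (_ + _).
  rewrite -big_split/=; apply: eq_bigr => j _.
  by rewrite subSn ?(ltnW (ltn_ord j))// -natr1 mulrDl mul1r.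
elim: n => [|n IH]; first by rewrite big_ord0 mulr0 exprn_ge0.
rewrite S mulrDr; have := P n; lra.
Qed.

(* Green's formula for the second order recurrence satisfied by [chebT]:
   [chebW] is the fundamental solution. *)
Lemma cheb_green x (a r : nat -> R) : a 0 = 0 -> a 1 = r 0 ->
  (forall n, a n.+2 = 2 * x * a n.+1 - a n + r n.+1) ->
  forall n, a n = \sum_(j < n) W (n - j) x * r j.
Proof.
move=> a0 a1 aS n; set S := fun n => \sum_(j < n) W (n - j) x * r j.
have W1 : W 1 x = 1 by rewrite chebW_eq chebW0 chebT0 mulr0 add0r.
have SS m : S m.+2 = 2 * x * S m.+1 - S m + r m.+1.
  rewrite /S big_ord_recr/= subSnn W1 mul1r; congr (_ + _).
  rewrite !big_ord_recr/= subSnn W1 -addn2 addKn mulrDr [in RHS]addrAC; congr (_ + _); last first.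
    by rewrite chebW_eq chebT_eq chebW0 chebT0 W1; ring.
  rewrite mulr_sumr -sumrB; apply: eq_bigr => j _.
  rewrite addn2 !subSn ?(ltnW (ltn_ord j))// ?leqW ?(ltnW (ltn_ord j))//.
  by rewrite chebWSS !(hornerD, hornerN, hornerM, hornerMn, hornerX); ring.
suff [] : a n = S n /\ a n.+1 = S n.+1 by [].
elim: n => [|n [IH1 IH2]]; last by split=> //; rewrite aS SS IH1 IH2.
by rewrite /S big_ord0 big_ord_recr big_ord0/= subn0 W1 mul1r add0r.
Qed.

Lemma derivn_chebTSS k n x :
  (chebT n.+2)^`(k.+1).[x] = 2 * x * (chebT n.+1)^`(k.+1).[x] -
     (chebT n)^`(k.+1).[x] + 2 * k.+1%:R * (chebT n.+1)^`(k).[x].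
Proof.
rewrite chebTSS derivnB derivnMn !derivn_XM/= !(hornerD, hornerN, hornerM, hornerMn, hornerX); ring.
Qed.

(** As sequences in n, the derivatives of order k+1 satisfy the Chebyshev recurrence with source
    2(k+1) times those of order k, so [cheb_green] turns growth n^(2k) into n^(2k+2). The majorant
    [tau] will be 1 on [-1, 1] and T_n(x) for x >= 1. *)
Lemma derivn_chebT_bound (x : R) (tau : nat -> R) :
  {homo tau : m n / (m <= n)%N >-> m <= n} ->
  (forall n, `|T n x| <= tau n) ->
  (forall l j, `|W l x| * tau j <= l%:R * tau (l + j)%N) ->
  forall k n, `|(chebT n)^`(k).[x]| <= n%:R ^+ (2 * k) / k`!%:R * tau n.
Proof.
move=> tmono tT tW.
have t0 n : 0 <= tau n by rewrite (le_trans _ (tT n)).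
have t01 : 1 <= tau 0 by have := tT 0; rewrite chebT0 normr1.
case; first by move=> n; rewrite derivn0 muln0 expr0 fact0 divr1 mul1r.
(* Order one goes through T_n' = n W_n, because [sum_weighted_powers] asks for a positive exponent:
   with exponent 0 the term j = 0 would break the bound. *)
elim=> [|k IH] n.
  rewrite derivn1 deriv_chebT hornerMn factS fact0 divr1 muln1 -mulr_natl normrM normr_nat.
  rewrite expr2 -mulrA ler_wpM2l//.
  apply: le_trans (_ : `|W n x| * tau 0 <= _); first by rewrite ler_peMr.
  by rewrite (le_trans (tW _ _))// addn0.
pose r j : R := if j is j'.+1 then 2 * k.+2%:R * (chebT j)^`(k.+1).[x] else 0.
have a0 : (chebT 0)^`(k.+2).[x] = 0.
  by rewrite derivn_poly0 ?horner0 ?(leq_trans (size_chebT 0)).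
have sz1 : (size (chebT 1) <= k.+2)%N by apply: (leq_trans (size_chebT 1)).
have a1 : (chebT 1)^`(k.+2).[x] = r 0%N by rewrite derivn_poly0 ?horner0.
rewrite (@cheb_green x (fun n => (chebT n)^`(k.+2).[x]) r a0 a1); last first.
  by move=> m; rewrite derivn_chebTSS.
apply: le_trans (ler_norm_sum _ _ _) _.
have q0 : (0 < 2 * k.+1)%N by [].
have B := sum_weighted_powers n q0.
have rb (j : nat) : `|r j| <= 2 * k.+2%:R * (j%:R ^+ (2 * k.+1) / (k.+1)`!%:R * tau j).
  case: j => [|j] /=; first by rewrite normr0 !mulr_ge0 ?exprn_ge0 ?invr_ge0.
  by rewrite normrM (ger0_norm (_ : 0 <= 2 * k.+2%:R)) ?mulr_ge0// ler_wpM2l ?mulr_ge0//; exact: IH.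
apply: (@le_trans _ _ (\sum_(j < n) (2 * k.+2%:R / (k.+1)`!%:R * tau n) * ((n - j)%:R * j%:R ^+
  (2 * k.+1)))).
  apply: ler_sum => j _; rewrite normrM.
  apply: (le_trans (ler_wpM2l (normr_ge0 _) (rb j))).
  have -> : `|W (n - j) x| * (2 * k.+2%:R * (j%:R ^+ (2 * k.+1) / (k.+1)`!%:R * tau j))
    = (2 * k.+2%:R / (k.+1)`!%:R * j%:R ^+ (2 * k.+1)) * (`|W (n - j) x| * tau j) by ring.
  have -> : (2 * k.+2%:R / (k.+1)`!%:R * tau n) * ((n - j)%:R * j%:R ^+ (2 * k.+1)) =
    (2 * k.+2%:R / (k.+1)`!%:R * j%:R ^+ (2 * k.+1)) * ((n - j)%:R * tau n) by ring.
  apply: ler_wpM2l; first by rewrite !mulr_ge0 ?exprn_ge0 ?invr_ge0.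
  by rewrite (le_trans (tW _ _))// subnK// ltnW.
rewrite -mulr_sumr mulrAC ler_wpM2r//.
set S := \sum_(j < n) _ in B *.
have S0 : 0 <= S by apply: sumr_ge0 => j _; rewrite mulr_ge0 ?exprn_ge0.
have -> : (2 * k.+2 = (2 * k.+1).+2)%N by rewrite !mulnS.
have f0 : (k.+1)`!%:R != 0 :> R by rewrite pnatr_eq0 -lt0n fact_gt0.
have -> : (k.+2)`!%:R = k.+2%:R * (k.+1)`!%:R :> R by rewrite factS natrM.
rewrite ler_pdivlMr ?mulr_gt0 ?ltr0n ?fact_gt0//; apply: le_trans B.
have -> : 2 * k.+2%:R / (k.+1)`!%:R * S * (k.+2%:R * (k.+1)`!%:R) = (2 * k.+2 * k.+2)%:R * S :> R.
  by move: f0; move: (k.+1)`!%:R => f f0; rewrite !natrM; field.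
(* What remains is 2 (k+2)^2 <= (2k+4)(2k+3). *)
by rewrite -!natrM ler_wpM2r// ler_nat; lia.
Qed.

Lemma derivn_chebT_le1 k n x : `|x| <= 1 ->
  `|(chebT n)^`(k).[x]| <= n%:R ^+ (2 * k) / k`!%:R.
Proof.
move=> x1; have := @derivn_chebT_bound x (fun=> 1) _ _ _ k n.
rewrite mulr1; apply => // [m|l j]; first exact: chebT_le1.
by rewrite !mulr1 chebW_len.
Qed.

Lemma derivn_chebT_ge1 k n x y : 1 <= x -> x <= y ->
  `|(chebT n)^`(k).[x]| <= n%:R ^+ (2 * k) / k`!%:R * T n y.
Proof.
move=> x1 xy; apply: le_trans (_ : n%:R ^+ (2 * k) / k`!%:R * T n x <= _); last first.
  by rewrite ler_wpM2l ?chebT_incr// mulr_ge0 ?exprn_ge0 ?invr_ge0.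
apply: (@derivn_chebT_bound x (fun n => T n x)) => [|m|l j].
- exact: chebT_mono.
- by rewrite ger0_norm//; have [] := chebTW_ge0 m x1; lra.
- by rewrite ger0_norm ?chebWT_le//; have [] := chebTW_ge0 l x1.
Qed.

Lemma chebT_joukowski n (g : R) : g != 0 ->
  T n ((g + g^-1) / 2) = (g ^+ n + g ^- n) / 2.
Proof.
move=> g0; elim/ltn_ind: n => -[_|[_|n IH]].
- by rewrite chebT0 expr0 invr1; field.
- by rewrite chebT_eq chebT0 chebW0 expr1; field.
- rewrite chebT_eq2 IH// IH// !exprS; field.
  by rewrite g0 expf_neq0.
Qed.

End Chebyshev.

(** * Growth of a block *)

Section PolyDerivatives.
Variable R : realFieldType.
Implicit Types (p : {poly R}) (x z beta : R).

Lemma fact_gt0R n : 0 < n`!%:R :> R.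
Proof. by rewrite ltr0n fact_gt0. Qed.

Lemma derivn_horner0 p k : p^`(k).[0] = p`_k *+ k`!.
Proof. by rewrite horner_coef0 coef_derivn addn0 ffactnn. Qed.

Lemma derivn_comp_affine p (a b : R) k :
  (p \Po (a%:P + b *: 'X))^`(k) = b ^+ k *: (p^`(k) \Po (a%:P + b *: 'X)).
Proof.
elim: k => [|k IH]; first by rewrite !derivn0 expr0 scale1r.
rewrite !derivnS IH derivZ deriv_comp derivD derivC derivZ derivX add0r exprSr.
by rewrite alg_polyC mulrC mul_polyC scalerA.
Qed.

(** This is the shape of the bound d^(2k)/k! on the derivatives of T_d after rescaling; against
    weights like k! theta^k it leaves a geometric series of ratio theta z. *)
Definition deriv_bound p x beta z :=
  forall k, `|p^`(k).[x]| <= beta * (z ^+ k / k`!%:R).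

Lemma sqr_le_exp2 k : (k * k <= 4 * 2 ^ k)%N.
Proof.
elim: k => // k IH; have : (k < 2 ^ k)%N by rewrite ltn_expl.
by rewrite expnS; case: (leqP k 3) => [|?]; [case: k IH => [|[|[|[|]]]]|nia].
Qed.

(** The product rule adds k p^(k-1), which relative to z^k/k! costs a factor k^2/z; as k^2 <= 4 2^k,
    doubling z absorbs it. *)
Lemma deriv_bound_mulX p x beta z : 0 <= beta -> 0 < z ->
  deriv_bound p x beta z -> deriv_bound ('X * p) x (beta * (`|x| + 4 / z)) (2 * z).
Proof.
move=> b0 z0 H k; rewrite derivn_XM hornerD hornerM hornerX hornerMn.
apply: le_trans (ler_normD _ _) _; rewrite normrM normrMn.
rewrite -mulrA mulrDl mulrDr; apply: lerD.
  apply: (@le_trans _ _ (`|x| * (beta * (z ^+ k / k`!%:R)))).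
    by rewrite ler_wpM2l.
  rewrite mulrCA; apply: ler_wpM2l => //; apply: ler_wpM2l => //.
  by rewrite ler_wpM2r ?invr_ge0// lerXn2r ?nnegrE ?mulr_ge0 ?(ltW z0)//; lra.
case: k => [|k]; first by rewrite mulr0n !mulr_ge0 ?invr_ge0 ?(ltW z0)// ?mulr_ge0.
rewrite /= -[_ *+ k.+1]mulr_natl; apply: (@le_trans _ _ (k.+1%:R * (beta * (z ^+ k / k`!%:R)))).
  by rewrite ler_wpM2l.
rewrite mulrCA; apply: ler_wpM2l => //.
have E : (k.+1)`!%:R = k.+1%:R * k`!%:R :> R by rewrite factS natrM.
rewrite E; have f0 := fact_gt0R k; move: (k`!%:R) f0 => f f0.
have -> : 4 / z * ((2 * z) ^+ k.+1 / (k.+1%:R * f)) = (4 * 2 ^+ k.+1 / k.+1%:R) * (z ^+ k / f).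
  rewrite exprMn [z ^+ k.+1]exprS; field.
  by rewrite !lt0r_neq0// addrC natr1 ltr0n.
rewrite ler_wpM2r ?divr_ge0 ?exprn_ge0 ?(ltW f0) ?(ltW z0)//.
by rewrite ler_pdivlMr ?ltr0n// -!natrX -!natrM ler_nat sqr_le_exp2.
Qed.

Lemma deriv_bound_mulXn m p x beta z : 0 <= beta -> 0 < z ->
  deriv_bound p x beta z ->
  deriv_bound ('X^m * p) x (beta * (`|x| + 4 / z) ^+ m) (2 ^+ m * z).
Proof.
move=> b0 z0 H; elim: m => [|m IH]; first by rewrite !expr0 !mul1r mulr1.
have xz : 0 <= `|x| + 4 / z by rewrite addr_ge0// divr_ge0 ?(ltW z0).
have := fun b c => deriv_bound_mulX b c IH;
  rewrite [2 * _]mulrA -exprS mulrA -exprS => /(_ _ _) K k.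
apply: le_trans (K _ _ k) _; first by rewrite mulr_ge0 ?exprn_ge0.
  by rewrite mulr_gt0 ?exprn_gt0.
rewrite ler_wpM2r ?divr_ge0 ?exprn_ge0 ?mulr_ge0 ?exprn_ge0 ?(ltW z0)//.
rewrite exprSr mulrA ler_wpM2l ?mulr_ge0 ?exprn_ge0// lerD2l.
rewrite ler_wpM2l// lef_pV2 ?posrE ?mulr_gt0 ?exprn_gt0//.
by rewrite ler_peMl ?(ltW z0)// exprn_ege1//; lra.
Qed.

(** By Taylor's formula p(x + t) is the sum of the p^(k)(x) t^k/k!, so for p of degree below n this
    majorizes the norm of the vector standing for that translate. *)
Definition wnorm (g : nat -> R) n p x := \sum_(k < n) g k * `|p^`(k).[x]|.

End PolyDerivatives.

(** * Geometric, factorial and harmonic sums *)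

Section Sums.
Variable R : realFieldType.

Lemma sum_geometric_half n : \sum_(i < n) (1 / 2) ^+ i <= 2 :> R.
Proof.
suff -> : \sum_(i < n) (1 / 2) ^+ i = 2 - 2 * (1 / 2) ^+ n :> R.
  by rewrite lerBlDr lerDl mulr_ge0// exprn_ge0//; lra.
elim: n => [|n IH]; first by rewrite big_ord0 expr0; ring.
by rewrite big_ord_recr/= IH exprS; field.
Qed.

Lemma sum_inv_fact n : \sum_(j < n) (n - j)`!%:R^-1 <= 2 :> R.
Proof.
rewrite (reindex_inj rev_ord_inj)/=; apply: le_trans (sum_geometric_half n).
apply: ler_sum => j _; rewrite subKn ?ltn_ord//.
rewrite mul1r exprVn lef_pV2 ?posrE ?exprn_gt0 ?fact_gt0R//.
rewrite -natrX ler_nat; elim: (nat_of_ord j) => // k IH.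
by rewrite factS expnS leq_mul.
Qed.

Lemma harmonic_pow2 p : \sum_(i < 2 ^ p) i.+1%:R^-1 <= p.+1%:R :> R.
Proof.
elim: p => [|p IH]; first by rewrite expn0 big_ord_recr big_ord0/= add0r invr1.
rewrite expnS mul2n -addnn big_split_ord/= -natr1 lerD//.
apply: (@le_trans _ _ (\sum_(i < 2 ^ p) (2 ^ p)%:R^-1)).
  apply: ler_sum => i _; rewrite lef_pV2 ?posrE ?ltr0n ?expn_gt0// ler_nat.
  by rewrite leqW// leq_addr.
by rewrite sumr_const card_ord -[X in X <= _]mulr_natl divff// pnatr_eq0 -lt0n expn_gt0.
Qed.

Lemma sum_lt_count (N : nat) (t : R) : 0 <= t ->
  \sum_(1 <= i < N.+1) (i%:R < t)%R%:R <= t.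
Proof.
move=> t0; suff [] : \sum_(1 <= i < N.+1) (i%:R < t)%R%:R <= t /\
   \sum_(1 <= i < N.+1) (i%:R < t)%R%:R <= N%:R :> R by move=> ? _.
elim: N => [|N [IH1 IH2]]; first by rewrite big_geq.
rewrite big_nat_recr//=; case: ltP => ht; split; rewrite ?addr0//.
- rewrite -natr1 in ht; rewrite mulr1n; lra.
- by rewrite -[N.+1%:R]natr1 lerD.
- by rewrite (le_trans IH2)// ler_nat.
Qed.

End Sums.

Lemma bin_le_exp2 n m : ('C(n, m) <= 2 ^ n)%N.
Proof.
elim: n m => [|n IH] [|m]; rewrite ?bin0 ?expn_gt0// binS expnS mul2n -addnn.
exact: leq_add.
Qed.

(** Q^(p+1) is at most a falling factorial, that is (p+1)! times a binomial coefficient bounded by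
    2^(Q+p+1); the spare factor Q then beats the constants. *)
Lemma exp2_beats_power (R : archiRealFieldType) (C : R) (p : nat) :
  exists Q0, forall Q, (Q0 <= Q)%N -> C * Q%:R ^+ p <= 2 ^+ Q.
Proof.
have H (Q : nat) : Q%:R ^+ p.+1 <= (p.+1`! * 2 ^ p.+1)%:R * 2 ^+ Q :> R.
  rewrite -!natrX -natrM ler_nat -mulnA -expnD.
  apply: (@leq_trans ((Q + p.+1) ^_ p.+1)).
    elim: p.+1 => // k IH; rewrite expnS addnS ffactSS.
    by rewrite leq_mul// -addnS leq_addr.
  by rewrite -bin_ffact mulnC leq_mul// addnC bin_le_exp2.
pose D := (p.+1`! * 2 ^ p.+1)%:R : R.
have D0 : 0 < D by rewrite ltr0n muln_gt0 fact_gt0 expn_gt0.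
exists (Num.truncn (C * D)).+1 => Q hQ.
have CQ : C * D <= Q%:R.
  by rewrite ltW// (lt_le_trans (truncnS_gt _))// ler_nat.
have Q0 : 0 < Q%:R :> R by rewrite ltr0n; lia.
have := H Q; rewrite -/D exprS => HQ.
rewrite -(ler_pM2l D0); apply: le_trans HQ.
by rewrite mulrA [D * C]mulrC ler_wpM2r// exprn_ge0// ltW.
Qed.

(** F is T_d(x_0 - h t)/T_d(x_0) with h = y/d^2: thus h^k d^(2k)/k! is y^k/k!, and t in [0, L]
    corresponds to [x_0 - 1, x_0]. Once h t >= x_0 - 1 the argument lies in [-1, 1], where T_d
    brings no growth and the factor 1/T_d(x_0) remains. *)
Lemma cheb_profile (R : realFieldType) (Q : nat) (y : R) : (0 < Q)%N -> 0 < y ->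
  let d := (Q ^ 2 * 2 ^ Q)%N in let L := d%:R ^+ 2 / y in
  exists F : {poly R}, [/\ (size F <= d.+1)%N, F`_0 = 1,
    forall x, 0 <= x -> x <= L -> deriv_bound F x 1 y &
    forall x, L / (2 * 4 ^+ Q) <= x -> x <= L ->
      deriv_bound F x (2 / 2 ^+ (Q ^ 2)) y].
Proof.
move=> Q0 y0 d L.
(* x_0 is the Joukowski image of g = 1 + 2^(-Q). This gives x_0 - 1 <= 4^(-Q)/2 and, by Bernoulli's
   inequality and d = Q^2 2^Q, also T_d(x_0) >= g^d/2 >= 2^(Q^2)/2. *)
pose e : R := 2 ^+ Q; have e1 : 1 <= e by rewrite exprn_ege1//; lra.
pose g := 1 + e^-1; have ei0 : 0 < e^-1 by rewrite invr_gt0; lra.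
have g1 : 1 < g by rewrite /g; lra.
have g0 : g != 0 by rewrite gt_eqF//; lra.
pose x0 := (g + g^-1) / 2.
have x01E : x0 - 1 = (g - 1) ^+ 2 / (2 * g) by rewrite /x0; field.
have x01 : 0 <= x0 - 1.
  by rewrite x01E divr_ge0 ?sqr_ge0//; lra.
have x01le : x0 - 1 <= (2 * 4 ^+ Q)^-1.
  rewrite x01E /g [1 + _]addrC addrK -/g exprVn -invfM ler_pV2 ?inE; last 2 first.
  - by rewrite unitfE gt_eqF ?mulr_gt0 ?exprn_gt0//=; lra.
  - rewrite unitfE gt_eqF ?mulr_gt0 ?exprn_gt0//=; lra.
  have -> : 4 ^+ Q = e ^+ 2 :> R.
    by rewrite -exprM mulnC exprM; congr (_ ^+ _); rewrite expr2 -natrM.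
  rewrite [leRHS]mulrC ler_wpM2r ?sqr_ge0//; lra.
have T0 : 1 <= (chebT R d).[x0] by have [] := @chebTW_ge0 R d x0; lra.
have d0 : (0 < d)%N by rewrite muln_gt0 !expn_gt0 Q0.
have dR : 0 < d%:R ^+ 2 :> R by rewrite exprn_gt0// ltr0n.
have Lam : (chebT R d).[x0]^-1 <= 2 / 2 ^+ (Q ^ 2).
  rewrite -[leRHS]invrK lef_pV2 ?posrE ?invr_gt0 ?divr_gt0 ?exprn_gt0//; last by lra.
  rewrite chebT_joukowski// invfM invrK mulrC ler_pM2r ?invr_gt0//.
  apply: (@le_trans _ _ (g ^+ d)); last by rewrite lerDl invr_ge0 exprn_ge0//; lra.
  rewrite /d mulnC exprM lerXn2r ?nnegrE ?exprn_ge0//; first lra.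
  have bern n (u : R) : 0 <= u -> 1 + n%:R * u <= (1 + u) ^+ n.
    move=> u0; elim: n => [|n IH]; first by rewrite mul0r addr0 expr0.
    have n0 : 0 <= n%:R * u by rewrite mulr_ge0.
    rewrite exprS -natr1; nra.
  apply: le_trans (bern _ _ (ltW ei0)).
  by rewrite natrX divff ?gt_eqF//; lra.
set a := (chebT R d).[x0] in T0 Lam.
pose h := y / d%:R ^+ 2; have h0 : 0 < h by rewrite divr_gt0.
have Lh : L * h = 1 by rewrite /L /h; field; rewrite !gt_eqF ?ltr0n.
pose F := a^-1 *: (chebT R d \Po (x0%:P + (- h) *: 'X)).
have dF k x : `|F^`(k).[x]| = a^-1 * (h ^+ k * `|(chebT R d)^`(k).[x0 - h * x]|).
  rewrite /F derivnZ derivn_comp_affine !hornerZ horner_comp !normrM normrX normrN.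
  by rewrite (gtr0_norm h0) hornerD hornerC hornerZ hornerX mulNr gtr0_norm// invr_gt0; lra.
have hd k : h ^+ k * (d%:R ^+ (2 * k) / k`!%:R) = y ^+ k / k`!%:R.
  by rewrite exprM mulrA -exprMn /h divfK// gt_eqF.
exists F; split.
- apply: leq_trans (size_scale_leq _ _) _; apply: leq_trans (size_comp_poly_leq _ _) _.
  rewrite ltnS; have s1 : (size (x0%:P + (- h) *: 'X : {poly R})%R <= 2)%N.
    apply: leq_trans (size_polyD _ _) _; rewrite geq_max size_polyC.
    rewrite (leq_trans (leq_b1 _))//=; apply: leq_trans (size_scale_leq _ _) _.
    by rewrite size_polyX.
  have s2 := size_chebT R d.
  by apply: (@leq_trans (d * 1)); [apply: leq_mul; lia | rewrite muln1].
- rewrite -horner_coef0 /F hornerZ horner_comp hornerD hornerC hornerZ hornerX mulr0 addr0.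
  by rewrite mulVf// gt_eqF//; lra.
- move=> x x0' xL k; rewrite dF mul1r -hd.
  have hx0 : 0 <= h * x by rewrite mulr_ge0// ltW.
  have hx1 : h * x <= 1 by rewrite -Lh mulrC ler_wpM2r// ltW.
  rewrite mulrCA ler_wpM2l ?exprn_ge0 ?(ltW h0)// ler_pdivrMl; last by lra.
  have [x1|x1] := leP 1 (x0 - h * x).
    rewrite [leRHS]mulrC; apply: derivn_chebT_ge1 => //; lra.
  apply: le_trans (derivn_chebT_le1 _ _ _) _; first by rewrite ler_norml; lra.
  by rewrite ler_peMl ?divr_ge0 ?exprn_ge0.
- move=> x xl xL k; rewrite dF -hd.
  have hx1 : h * x <= 1 by rewrite -Lh mulrC ler_wpM2r// ltW.
  have hx2 : x0 - 1 <= h * x.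
    apply: (le_trans x01le); have := ler_wpM2l (ltW h0) xl; apply: le_trans.
    by rewrite mulrA [h * L]mulrC Lh mul1r.
  rewrite mulrCA [leRHS]mulrCA ler_wpM2l ?exprn_ge0 ?(ltW h0)//.
  apply: ler_pM => //; first by rewrite invr_ge0; lra.
  by apply: derivn_chebT_le1; rewrite ler_norml; lra.
Qed.

(** * Weights of factorial growth *)

Section Block.
Variable R : realType.
Variables (s : nat) (g : nat -> R) (eps : R).
Hypothesis s0 : (0 < s)%N.
Hypothesis g0 : forall k, (k < s)%N -> 0 < g k.
Hypothesis eps0 : 0 < eps.
Hypothesis eps1 : eps <= 1.

Variables G rho : R.
Hypothesis blockG_ge1 : 1 <= G.
Hypothesis le_blockG : forall k, (k < s)%N -> g k <= G.
Hypothesis blockrho_gt0 : 0 < rho.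
Hypothesis blockrho_eq : rho * (G * 2 ^+ (s + 2) * (s + 4)%:R) = eps.

(** One factorial cancels the k! of [deriv_bound], and the weight of index s + i is at least (i+1)
    theta times every bound available for the earlier ones, which is what [block_summable] uses. As
    b_k stands for t^k/k!, the monomials t^k themselves grow like (k!)^2 theta^k. *)
Definition block_ext (th : R) (n : nat) : R :=
  if (n < s)%N then g n else G * (n - s).+1`!%:R * th ^+ (n - s).+1.

(** This calibrates [blockrho_eq]: 2^s covers the loss 2^m of [deriv_bound_mulXn], the further
    factor 4 gives the 1/4 here, and s + 4 counts the terms in [block_wnorm_head]. *)
Lemma blockrho_small m : (m < s)%N -> 2 ^+ m * rho <= 1 / 4.
Proof.
move=> ms; have G1 := blockG_ge1; have r0 := blockrho_gt0.
have m2 : 2 ^+ m <= 2 ^+ s :> R by rewrite ler_eXn2l// ?ltr1n// ltnW.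
have s2 : 1 <= 2 ^+ s :> R by rewrite exprn_ege1//; lra.
have E := blockrho_eq; rewrite exprD natrD in E.
have s0' : 0 <= s%:R :> R by [].
have A : 1 <= G * (s%:R + 4%:R) by nra.
have B : 4 * (2 ^+ s * rho) <= eps.
  have Z : 0 <= 4 * (2 ^+ s * rho) by rewrite !mulr_ge0 ?exprn_ge0// ltW.
  rewrite -[leRHS]E; have /= := ler_wpM2l Z A; rewrite mulr1 => /le_trans; apply.
  by rewrite le_eqVlt; apply/orP; left; apply/eqP; ring.
apply: (le_trans (ler_wpM2r (ltW r0) m2)); rewrite ler_pdivlMr// mulrC; exact: le_trans B eps1.
Qed.

Section Ext.
Variable th : R.
Hypothesis th2 : 2 <= th.
Local Notation g' := (block_ext th).
Local Notation y := (rho / th).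

Lemma block_ext_lt k : (k < s)%N -> g' k = g k.
Proof.
have t2 := th2.
by rewrite /block_ext => ->. Qed.

Lemma block_ext_add i : g' (s + i)%N = G * i.+1`!%:R * th ^+ i.+1.
Proof.
have t2 := th2.
by rewrite /block_ext ltnNge leq_addr/= addKn. Qed.

Lemma block_ext_gt0 k : 0 < g' k.
Proof.
have t2 := th2.
have G1 := blockG_ge1; rewrite /block_ext; case: ifP => [/g0//|_].
by rewrite !mulr_gt0 ?exprn_gt0 ?fact_gt0R//; lra.
Qed.

Lemma block_ext_le i j : (j < s + i)%N -> g' j <= G * i`!%:R * th ^+ i.
Proof.
have t2 := th2.
have G1 := blockG_ge1; have th1 : 1 <= th by lra.
have [js _|sj] := ltnP j s.
  rewrite block_ext_lt//; apply: (le_trans (le_blockG js)).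
  rewrite -mulrA ler_peMr//; first lra.
  have := exprn_ege1 i th1; have : 1 <= i`!%:R :> R by rewrite ler1n fact_gt0.
  nra.
move=> ji; rewrite -(subnKC sj) block_ext_add -!mulrA ler_wpM2l//; first lra.
apply: ler_pM; rewrite ?exprn_ge0//; first lra.
  by rewrite ler_nat leq_fact//; lia.
by apply: ler_weXn2l => //; lia.
Qed.

(** Each term is at most 2/((i+1) theta): the earlier weights are at most G i! theta^i and the
    inverse factorials sum to at most 2. The harmonic sum is why a theta logarithmic in the length
    is enough. *)
Lemma block_summable M :
  \sum_(i < M) (g' (s + i)%N)^-1 * (\sum_(j < s + i) g' j / (s + i - j)`!%:R)
  <= 2 / th * \sum_(i < M) i.+1%:R^-1.
Proof.
have t2 := th2.
have G1 := blockG_ge1.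
rewrite mulr_sumr; apply: ler_sum => i _.
have H : \sum_(j < s + i) g' j / (s + i - j)`!%:R <= G * i`!%:R * th ^+ i * 2.
  apply: le_trans (_ : \sum_(j < s + i) G * i`!%:R * th ^+ i * (s + i - j)`!%:R^-1 <= _).
    by apply: ler_sum => j _; rewrite ler_wpM2r ?invr_ge0// block_ext_le.
  rewrite -mulr_sumr ler_wpM2l ?sum_inv_fact//.
  by rewrite !mulr_ge0 ?exprn_ge0//; lra.
apply: le_trans (ler_wpM2l _ H) _; first by rewrite invr_ge0 ltW// block_ext_gt0.
rewrite block_ext_add factS natrM exprS le_eqVlt; apply/orP; left; apply/eqP.
have f0 := fact_gt0R R i; move: (i`!%:R) f0 => f f0; field.
by rewrite addrC natr1 !gt_eqF ?exprn_gt0 ?ltr0n//; lra.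
Qed.

Lemma y_gt0 : 0 < y.
Proof.
have t2 := th2.
by rewrite divr_gt0 ?blockrho_gt0//; lra. Qed.

Lemma thy : th * y = rho.
Proof.
have t2 := th2.
by rewrite mulrC divfK// gt_eqF//; lra. Qed.

(** For z = 2^m y one has theta z = 2^m rho <= 1/4: the first s terms are at most G each, and the
    others are dominated by a geometric series of sum at most G. *)
Lemma block_wnorm_sum m M : (m < s)%N ->
  \sum_(k < s + M) g' k * ((2 ^+ m * y) ^+ k / k`!%:R) <= G * s.+1%:R.
Proof.
have t2 := th2.
move=> ms; have G1 := blockG_ge1; have sm := blockrho_small ms; have y0 := y_gt0.
have r0 := blockrho_gt0; have m0 : 0 < 2 ^+ m :> R by rewrite exprn_gt0.
set z := 2 ^+ m * y; have z0 : 0 <= z by rewrite mulr_ge0// ltW.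
have thz : th * z <= 1 / 4 by rewrite /z mulrCA thy.
have z1 : z <= 1 by have /= := ler_wpM2r z0 th2; lra.
rewrite big_split_ord/= -natr1 mulrDr mulr1; apply: lerD.
  apply: (@le_trans _ _ (\sum_(k < s) G)); last by rewrite sumr_const card_ord mulr_natr.
  apply: ler_sum => k _; rewrite block_ext_lt//.
  rewrite -[leRHS]mulr1; apply: ler_pM; rewrite ?le_blockG// ?(ltW (g0 _))//.
    by rewrite divr_ge0 ?exprn_ge0.
  by rewrite ler_pdivrMr ?fact_gt0R// mul1r (le_trans (exprn_ile1 _ _ _))// ler1n fact_gt0.
apply: (@le_trans _ _ (\sum_(i < M) G * (1 / 2) * (1 / 2) ^+ i)); last first.
  by rewrite -mulr_sumr; have := sum_geometric_half R M; nra.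
apply: ler_sum => i _; rewrite block_ext_add -!mulrA ler_wpM2l//; first lra.
have -> : 2^-1 * (1 / 2) ^+ i = (1 / 2) ^+ i.+1 :> R by rewrite exprS; field.
rewrite !mul1r; apply: (@le_trans _ _ (th ^+ i.+1 * z ^+ i.+1)); last first.
  rewrite -exprMn lerXn2r ?nnegrE ?mulr_ge0 ?invr_ge0//; lra.
rewrite mulrCA ler_wpM2l ?exprn_ge0//; first lra.
rewrite mulrCA -[leRHS]mulr1; apply: ler_pM; rewrite ?exprn_ge0 ?divr_ge0//.
  by apply: ler_wiXn2l => //; lia.
by rewrite ler_pdivrMr ?fact_gt0R// mul1r ler_nat leq_fact//; lia.
Qed.

Lemma block_wnorm_le m M (f : {poly R}) x beta : (m < s)%N -> 0 <= beta ->
  deriv_bound f x beta (2 ^+ m * y) ->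
  wnorm g' (s + M) f x <= beta * (G * s.+1%:R).
Proof.
have t2 := th2.
move=> ms b0 H; apply: le_trans (ler_wpM2l b0 (block_wnorm_sum M ms)).
rewrite mulr_sumr; apply: ler_sum => k _.
by rewrite mulrCA ler_wpM2l ?H// ltW// block_ext_gt0.
Qed.

(** As F(0) = 1, the difference has vanishing derivatives at 0 up to order m. Order k > m
    contributes at most 2^k y^(k-m)/(k-m)!, where 2^k bounds a binomial coefficient: s terms of size
    G 2^s rho, then a geometric series. *)
Lemma block_wnorm_head m M (F : {poly R}) : (m < s)%N -> F`_0 = 1 ->
  deriv_bound F 0 1 y ->
  wnorm g' (s + M) (m`!%:R^-1 *: ('X^m * F) - m`!%:R^-1 *: 'X^m) 0 <= eps.
Proof.
have t2 := th2.
move=> ms F0 H; have G1 := blockG_ge1; have sm := blockrho_small ms; have y0 := y_gt0.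
have r0 := blockrho_gt0; have sm0 : rho <= 1 / 4 by have := blockrho_small s0; rewrite expr0 mul1r.
have y1 : y <= 1 by have /= := ler_wpM2r (ltW y0) th2; rewrite thy; lra.
have Fl l : l`!%:R * `|F`_l| <= y ^+ l / l`!%:R.
  by have := H l; rewrite derivn_horner0 -[_ *+ l`!]mulr_natl normrM normr_nat mul1r.
rewrite -scalerBr.
have D k : `|(m`!%:R^-1 *: ('X^m * F - 'X^m))^`(k).[0]| <=
   if (m < k)%N then 2 ^+ k * (y ^+ (k - m) / (k - m)`!%:R) else 0.
  rewrite derivn_horner0 coefZ coefB coefXnM coefXn.
  have [km|km|->] := ltngtP k m.
  - by rewrite subr0 mulr0 mul0rn normr0.
  - rewrite subr0 -mulrnAr normrM ger0_norm ?invr_ge0// normrMn -[`|_| *+ _]mulr_natl.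
    have bE : k`!%:R = 'C(k, m)%:R * (m`!%:R * (k - m)`!%:R) :> R.
      by rewrite -!natrM bin_fact// ltnW.
    rewrite bE; have f0 := fact_gt0R R m; move: (m`!%:R) f0 => f f0.
    have -> : f^-1 * ('C(k, m)%:R * (f * (k - m)`!%:R) * `|F`_(k - m)|) =
       'C(k, m)%:R * ((k - m)`!%:R * `|F`_(k - m)|) by field; rewrite gt_eqF.
    apply: ler_pM; rewrite ?Fl ?mulr_ge0//.
    by rewrite -natrX ler_nat bin_le_exp2.
  - by rewrite subnn F0 subrr mulr0 mul0rn normr0.
have s2 k : (k <= s)%N -> 2 ^+ k <= 2 ^+ s :> R by move=> ?; rewrite ler_eXn2l ?ltr1n.
have S2 : 1 <= 2 ^+ s :> R by rewrite exprn_ege1//; lra.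
have yrho : y <= rho by rewrite -[leRHS]thy ler_peMl ?(ltW y0)//; lra.
apply: (@le_trans _ _ (\sum_(k < s) G * 2 ^+ s * rho + \sum_(i < M) G * 2 ^+ s * (2 * rho) * (1 /
  2) ^+ i)).
  rewrite /wnorm big_split_ord/=; apply: lerD; apply: ler_sum => i _.
    rewrite block_ext_lt// -mulrA; apply: ler_pM => //; [exact/ltW/g0|exact: le_blockG|].
    apply: le_trans (D i) _; case: ifP => [mi|_]; last by rewrite mulr_ge0 ?exprn_ge0// ltW.
    apply: ler_pM; rewrite ?exprn_ge0 ?divr_ge0 ?exprn_ge0 ?(ltW y0)//; first exact/s2/ltnW.
    rewrite ler_pdivrMr ?fact_gt0R//; apply: (@le_trans _ _ y).
      by rewrite -[leRHS]expr1; apply: ler_wiXn2l; rewrite ?(ltW y0)//; lia.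
    by apply: (le_trans yrho); rewrite ler_peMr ?(ltW r0)// ler1n fact_gt0.
  rewrite block_ext_add; apply: le_trans (ler_wpM2l _ (D _)) _.
    by rewrite !mulr_ge0 ?exprn_ge0//; lra.
  rewrite (leq_trans ms) ?leq_addr// exprD.
  set l := (s + i - m)%N; have li : (i < l)%N by rewrite /l; lia.
  have -> : G * i.+1`!%:R * th ^+ i.+1 * (2 ^+ s * 2 ^+ i * (y ^+ l / l`!%:R)) =
    G * 2 ^+ s * (2 ^+ i * (th ^+ i.+1 * (y ^+ l * (i.+1`!%:R / l`!%:R)))) by ring.
  rewrite -!mulrA ler_wpM2l//; first lra.
  rewrite ler_wpM2l ?exprn_ge0//.
  apply: (@le_trans _ _ (2 ^+ i * (th ^+ i.+1 * y ^+ i.+1))).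
    rewrite !ler_wpM2l ?exprn_ge0//; first lra.
    rewrite -[leRHS]mulr1; apply: ler_pM; rewrite ?exprn_ge0 ?(ltW y0) ?divr_ge0//.
      by apply: ler_wiXn2l => //; rewrite ltW.
    by rewrite ler_pdivrMr ?fact_gt0R// mul1r ler_nat leq_fact.
  rewrite -exprMn thy exprS mulrCA -exprMn.
  have : (2 * rho) ^+ i <= (1 / 2) ^+ i.
    by rewrite lerXn2r ?nnegrE ?mulr_ge0 ?(ltW r0)//; lra.
  have : 0 <= (1 / 2) ^+ i :> R by rewrite exprn_ge0//; lra.
  rewrite mul1r; nra.
rewrite sumr_const card_ord -mulr_sumr -[_ *+ s]mulr_natr.
have E := blockrho_eq; rewrite exprD natrD in E.
have := sum_geometric_half R M; set S := \sum_(i < M) _ => S1.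
have P : 0 <= G * 2 ^+ s * rho by rewrite !mulr_ge0 ?(ltW r0)//; lra.
have PS : G * 2 ^+ s * rho * S <= G * 2 ^+ s * rho * 2 by rewrite ler_wpM2l.
have sR : 0 <= s%:R :> R by [].
have Ps := mulr_ge0 P sR; rewrite -[leRHS]E.
set P' := G * 2 ^+ s * rho in P PS Ps *.
have -> : rho * (G * (2 ^+ s * 2 ^+ 2) * (s%:R + 4%:R)) = 4 * (P' * s%:R) + 16 * P'.
  by rewrite /P'; ring.
have -> : G * 2 ^+ s * (2 * rho) * S = 2 * (P' * S) by rewrite /P'; ring.
lra.
Qed.

End Ext.
End Block.

(* [f] approximates t^m/m! and its translates by 1, ..., N are small on average;
   the weight [g k] is to be the norm of the vector representing t^k/k!. *)
Definition block_good (R : realType) (s M N0 : nat) (g : nat -> R) (eps : R) :=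
  exists2 N : nat, (N0 < N)%N & forall m, (m < s)%N -> exists f : {poly R},
  [/\ (size f <= s + M)%N,
      wnorm g (s + M) (f - m`!%:R^-1 *: 'X^m) 0 <= eps,
      \sum_(1 <= i < N.+1) wnorm g (s + M) f i%:R <= eps * N%:R &
      wnorm g (s + M) f N%:R <= eps].

Lemma block_le1 (R : realType) (s : nat) (g : nat -> R) (eps : R) (N0 : nat) :
  (0 < s)%N -> (forall k, (k < s)%N -> 0 < g k) -> 0 < eps -> eps <= 1 ->
  exists (M : nat) (g' : nat -> R),
  [/\ forall k, (k < s)%N -> g' k = g k, forall k, 0 < g' k,
    \sum_(i < M) (g' (s + i)%N)^-1 * (\sum_(j < s + i) g' j / (s + i - j)`!%:R) <= eps
    & block_good s M N0 g' eps].
Proof.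
move=> s0 g0 eps0 eps1.
pose G : R := 1 + \sum_(k < s) g k.
have G1 : 1 <= G by rewrite lerDl sumr_ge0// => k _; rewrite ltW// g0.
have Gk k : (k < s)%N -> g k <= G.
  move=> ks; rewrite /G (bigD1 (Ordinal ks))//= addrCA lerDl addr_ge0//.
  by rewrite sumr_ge0// => i _; rewrite ltW// g0.
pose c0 := G * 2 ^+ (s + 2) * (s + 4)%:R.
have c00 : 0 < c0.
  by rewrite !mulr_gt0 ?exprn_gt0// ?ltr0n ?addn_gt0 ?orbT//; lra.
have [rho [rho0 rhoE]] : exists rho, 0 < rho /\ rho * c0 = eps.
  by exists (eps / c0); rewrite divr_gt0// divfK// gt_eqF.
have rho1 : rho <= 1 / 4.
  by have := blockrho_small eps1 G1 rho0 rhoE s0; rewrite expr0 mul1r.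
have er0 : 0 < eps * rho by rewrite mulr_gt0.
(* Here 40 is 5 times 8: both t0 + 4/y and (L + 4/y)/4^Q will be at most 5 Q^4/y, and 1/y at most 8
   Q/(eps rho). *)
pose c := 40 / (eps * rho).
have c1 : 1 <= c.
  rewrite /c ler_pdivlMr// mul1r; nra.
pose S := G * s.+1%:R.
have S1 : 1 <= S by rewrite /S -natr1; have : 0 <= s%:R :> R by []; nra.
have S0 : 0 <= S by exact: le_trans ler01 S1.
(* With this C, Q >= Q0 means 4 B^s S <= eps 2^Q for B = c Q^5, which is [BS] below. *)
pose C := 4 * S / eps * c ^+ s.
have [Q0 HQ0] := exp2_beats_power C (5 * s).
(* Every estimate reduces to the fact that 2^Q beats powers of Q: the polynomial F
   has degree d = Q^2 2^Q, N is of order d^2 Q, the part [0, t0] of [0, N] where F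
   is not small has length polynomial in Q, and F is of size 2^(-Q^2) beyond. *)
pose Q := (Q0 + N0 + (2 * s).+3)%N.
have Q1 : (0 < Q)%N by rewrite /Q addnS.
have QR : 1 <= Q%:R :> R by rewrite ler1n.
have HQ : C * Q%:R ^+ (5 * s) <= 2 ^+ Q by apply: HQ0; rewrite /Q -addnA leq_addr.
(* The factor 2^(-Q^2) has to pay 2^Q for B^s S and 2^(2 Q s) for the growth of t^m up to L. *)
have Q2 : (Q + 2 * Q * s <= Q ^ 2)%N.
  rewrite -mulnA mulnCA -mulnS expnS expn1 leq_mul2l; apply/orP; right.
  by apply: leq_trans (leq_addl _ _); rewrite ltnW// ltnW.
(* Since d <= 2^(3 Q), the harmonic sum in [block_summable] is at most 3 Q + 1; this theta brings
   the total down to eps. *)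
pose th : R := 2 * (3 * Q%:R + 1) / eps.
have thE : th * eps = 2 * (3 * Q%:R + 1) by rewrite /th divfK// gt_eqF.
have th2 : 2 <= th by rewrite /th ler_pdivlMr//; nra.
have th8 : th <= 8 * Q%:R / eps by rewrite /th ler_wpM2r ?invr_ge0 ?(ltW eps0)//; lra.
pose d := (Q ^ 2 * 2 ^ Q)%N.
pose y := rho / th; have th0 : 0 < th by lra.
have y0 : 0 < y by rewrite divr_gt0.
pose L := d%:R ^+ 2 / y.
have [F [szF F0 FL FR]] := cheb_profile Q1 y0.
rewrite -/d -/L in szF FL FR.
pose E4 : R := 4 ^+ Q; have E41 : 1 <= E4 by rewrite exprn_ege1// ler1n.
have E4p : 0 < E4 by exact: lt_le_trans ltr01 E41.
have E40 := ltW E4p.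
have dE : d%:R ^+ 2 = Q%:R ^+ 4 * E4 :> R.
  rewrite /d natrM exprMn !natrX /E4 (_ : 4 = 2 ^+ 2) -?exprM; last first.
    by rewrite expr2 -natrM.
  by rewrite [(2 * Q)%N]mulnC.
have yV : y^-1 = th / rho by rewrite /y invf_div.
have yV8 : y^-1 <= 8 * Q%:R / (eps * rho).
  by rewrite yV invfM mulrA ler_wpM2r ?invr_ge0 ?(ltW rho0).
have yVQ : 4 * y^-1 <= 4 * (8 * Q%:R / (eps * rho)) by lra.
have Q41 : 1 <= Q%:R ^+ 4 :> R by rewrite exprn_ege1.
have LQ : Q%:R <= L.
  rewrite /L dE yV; have t1 : 1 <= th / rho by rewrite ler_pdivlMr//; lra.
  have Qp : Q%:R <= Q%:R ^+ 4 :> R by rewrite ler_eXnr.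
  apply: (@le_trans _ _ (Q%:R ^+ 4 * E4)); first by nra.
  by rewrite ler_peMr// mulr_ge0 ?exprn_ge0.
have L1 : 1 <= L by exact: le_trans LQ.
have L0 : 0 <= L by exact: le_trans L1.
pose N := Num.truncn L.
have NL : N%:R <= L by have /andP[] := truncn_itv (le_trans ler01 L1).
have LN : L < N.+1%:R by have /andP[] := truncn_itv (le_trans ler01 L1).
have QN : (Q <= N)%N by rewrite -ltnS -(ltr_nat R) (le_lt_trans LQ).
have N0R : 1 <= N%:R :> R by rewrite ler1n (leq_trans Q1).
have L2N : L <= 2 * N%:R by move: LN; rewrite -natr1; lra.
(* F is tiny from here on. As d^2 = Q^4 4^Q, the point t0 is only Q^4/(2 y), while N is at least t0
   4^Q. *)
pose t0 := L / (2 * E4).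
have t00 : 0 <= t0 by rewrite divr_ge0// mulr_ge0.
have t0L : t0 <= L.
  by rewrite /t0 ler_pdivrMr ?mulr_gt0// ler_peMr// mulr_ege1// ler1n.
have t0N : t0 * E4 <= N%:R.
  by rewrite /t0 invfM mulrA divfK ?gt_eqF// ler_pdivrMr// mulrC.
have t0N' : t0 <= N%:R by apply: le_trans t0N; rewrite ler_peMr.
pose B := c * Q%:R ^+ 5.
have B1 : 1 <= B.
  have : 1 <= Q%:R ^+ 5 :> R by rewrite exprn_ege1.
  by rewrite /B; nra.
have B0 : 0 <= B by exact: le_trans B1.
have BS0 : 0 <= B ^+ s * S by rewrite mulr_ge0 ?exprn_ge0.
have BE : c * Q%:R ^+ 5 = 5 * Q%:R ^+ 4 * (8 * Q%:R / (eps * rho)).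
  by rewrite /c exprS; ring.
have q0 : 0 <= 8 * Q%:R / (eps * rho) by rewrite divr_ge0 ?mulr_ge0// ltW.
have t0B : t0 + 4 / y <= B.
  have -> : t0 = Q%:R ^+ 4 * y^-1 / 2 by rewrite /t0 /L dE; field; rewrite !gt_eqF//; lra.
  by rewrite /B BE; nra.
have LB : L + 4 / y <= B * E4.
  rewrite /B BE /L dE.
  have A1 : Q%:R ^+ 4 * E4 / y <= Q%:R ^+ 4 * E4 * (8 * Q%:R / (eps * rho)).
    by rewrite ler_wpM2l// mulr_ge0 ?exprn_ge0//; lra.
  have A2 : 8 * Q%:R / (eps * rho) <= Q%:R ^+ 4 * E4 * (8 * Q%:R / (eps * rho)).
    by rewrite ler_peMl//; nra.
  nra.
have powE (m : nat) (X : R) : (m < s)%N -> 1 <= X -> forall z : R, 0 <= z -> z <= X -> z ^+ m <=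
  X ^+ s.
  move=> ms X1 z z0 zX; apply: (@le_trans _ _ (X ^+ m)).
    by rewrite lerXn2r ?nnegrE ?(le_trans ler01 X1).
  by rewrite ler_weXn2l// ltnW.
have BS : 4 * (B ^+ s * S) <= eps * 2 ^+ Q.
  rewrite -ler_pdivrMl//; apply: le_trans HQ.
  by rewrite /C /B exprMn -exprM le_eqVlt; apply/orP; left; apply/eqP; ring.

pose beta : R := 2 / 2 ^+ (Q ^ 2).
have beta0 : 0 <= beta by rewrite divr_ge0.
have ya0 : 0 <= 4 / y by rewrite divr_ge0// ltW.
have far m x : (m < s)%N -> t0 <= x -> x <= L ->
    wnorm (block_ext s g G th) (s + d) (m`!%:R^-1 *: ('X^m * F)) x <= eps / 2.
  move=> ms tx xL.
  have H : deriv_bound ('X^m * F) x (beta * (`|x| + 4 / y) ^+ m) (2 ^+ m * y).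
    by apply: deriv_bound_mulXn => //; apply: FR.
  have Z : 0 <= beta * (`|x| + 4 / y) ^+ m by rewrite mulr_ge0 ?exprn_ge0 ?addr_ge0.
  apply: (@le_trans _ _ (beta * (`|x| + 4 / y) ^+ m * S)).
    apply: (block_wnorm_le s0 g0 eps0 eps1 G1 Gk rho0 rhoE th2 d ms Z) => k.
    rewrite derivnZ hornerZ normrM ger0_norm ?invr_ge0//; apply: le_trans (H k).
    by rewrite ler_piMl// invf_le1 ?fact_gt0R// ler1n fact_gt0.
  have P : (`|x| + 4 / y) ^+ m <= (B * E4) ^+ s.
    apply: powE => //; [exact: mulr_ege1|by rewrite addr_ge0|].
    by apply: le_trans LB; rewrite lerD2r ger0_norm// (le_trans t00).
  apply: (@le_trans _ _ (beta * (B * E4) ^+ s * S)).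
    by rewrite ler_wpM2r ?ler_wpM2l.
  rewrite exprMn /beta.
  have -> : 2 / 2 ^+ (Q ^ 2) * (B ^+ s * E4 ^+ s) * S =
     (4 * (B ^+ s * S)) * E4 ^+ s / (2 * 2 ^+ (Q ^ 2)).
    by field; rewrite expf_neq0// pnatr_eq0.
  have e0 : 0 < 2 * 2 ^+ (Q ^ 2) :> R by rewrite mulr_gt0 ?exprn_gt0.
  rewrite ler_pdivrMr//.
  have -> : eps / 2 * (2 * 2 ^+ (Q ^ 2)) = eps * 2 ^+ (Q ^ 2) by field.
  apply: (@le_trans _ _ (eps * 2 ^+ Q * E4 ^+ s)).
    by rewrite ler_wpM2r// exprn_ge0.
  rewrite -mulrA ler_wpM2l ?(ltW eps0)// /E4.
  have -> : 4 = 2 ^+ 2 :> R by rewrite expr2 -natrM.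
  by rewrite -!exprM -exprD ler_weXn2l ?ler1n// mulnA.
have near m x : (m < s)%N -> 0 <= x -> x <= t0 ->
    wnorm (block_ext s g G th) (s + d) (m`!%:R^-1 *: ('X^m * F)) x <= B ^+ s * S.
  move=> ms x0 xt.
  have H : deriv_bound ('X^m * F) x (1 * (`|x| + 4 / y) ^+ m) (2 ^+ m * y).
    by apply: deriv_bound_mulXn => //; apply: FL => //; exact: le_trans t0L.
  have Z : 0 <= 1 * (`|x| + 4 / y) ^+ m by rewrite mul1r ?exprn_ge0 ?addr_ge0.
  apply: (@le_trans _ _ (1 * (`|x| + 4 / y) ^+ m * S)).
    apply: (block_wnorm_le s0 g0 eps0 eps1 G1 Gk rho0 rhoE th2 d ms Z) => k.
    rewrite derivnZ hornerZ normrM ger0_norm ?invr_ge0//; apply: le_trans (H k).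
    by rewrite ler_piMl// invf_le1 ?fact_gt0R// ler1n fact_gt0.
  rewrite mul1r ler_wpM2r//.
  apply: powE => //; first by rewrite addr_ge0.
  by apply: le_trans t0B; rewrite lerD2r ger0_norm.
exists d, (block_ext s g G th); split.
- by move=> k ks; apply: block_ext_lt.
- by move=> k; apply: (block_ext_gt0 g0 G1 th2).
- apply: (le_trans (block_summable s0 g0 eps0 eps1 G1 Gk rho0 th2 d)).
  have d3 : (d <= 2 ^ (3 * Q))%N.
    rewrite /d [(3 * Q)%N]mulSn expnD mulnC leq_mul2l mulnC expnM leq_exp2r//.
    by rewrite (ltnW (ltn_expl _ _)) ?orbT.
  have H3 : \sum_(i < d) i.+1%:R^-1 <= 3 * Q%:R + 1 :> R.
    have := harmonic_pow2 R (3 * Q); rewrite -natr1 natrM; apply: le_trans.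
    rewrite -!(big_mkord xpredT (fun i => i.+1%:R^-1 : R)) (big_cat_nat _ d3)//= lerDl.
    by apply: sumr_ge0 => i _; rewrite invr_ge0.
  apply: (@le_trans _ _ (2 / th * (3 * Q%:R + 1))).
    by rewrite ler_wpM2l// divr_ge0// ltW.
  by rewrite mulrAC ler_pdivrMr// [eps * th]mulrC thE.
- exists N; first by apply: leq_trans QN; rewrite /Q !addnS ltnS -addnA addnCA leqW// leqW//
  leq_addr.
  move=> m ms; exists (m`!%:R^-1 *: ('X^m * F)); split.
  + apply: (leq_trans (size_scale_leq _ _)); apply: (leq_trans (size_polyMleq _ _)).
    rewrite size_polyXn addSn/=.
    by rewrite (leq_trans (leq_add (leqnn m) szF))// addnS -addSn leq_add2r.
  + apply: (block_wnorm_head s0 g0 eps0 eps1 G1 Gk rho0 rhoE th2) => //.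
    by apply: FL.
  (* At most t0 indices lie below t0, and together they contribute t0 B^s S <= eps t0 4^Q/4 <= eps
     N/4; each of the others contributes at most eps/2. *)
  + apply: (@le_trans _ _ (\sum_(1 <= i < N.+1) ((i%:R < t0)%R%:R * (B ^+ s * S) + eps / 2))).
      rewrite big_nat_cond [leRHS]big_nat_cond; apply: ler_sum => i /andP[/andP[i1 iN] _].
      have iL : i%:R <= L by apply: le_trans NL; rewrite ler_nat -ltnS.
      case: ltP => it0; rewrite ?mul1r ?mul0r.
        by apply: (le_trans (near m _ ms (ler0n _ i) (ltW it0))); rewrite lerDl divr_ge0// ltW.
      by rewrite add0r; apply: far.
    rewrite big_split/= -mulr_suml sumr_const_nat subn1/= -[_ *+ N]mulr_natr.
    have H := sum_lt_count N t00; set W := \sum_(_ <= _ < _) _ in H *.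
    have H2 : W * (B ^+ s * S) <= t0 * (B ^+ s * S).
      by rewrite ler_wpM2r.
    have H4 : 4 * (B ^+ s * S) <= eps * E4.
      apply: (le_trans BS); rewrite ler_wpM2l ?(ltW eps0)// /E4 lerXn2r ?nnegrE//.
      by rewrite ler_nat.
    have := ler_wpM2l t00 H4; have := ler_wpM2l (ltW eps0) t0N; nra.
  + apply: (le_trans (far m N%:R ms t0N' NL)); lra.
Qed.

Lemma block (R : realType) (s : nat) (g : nat -> R) (eps : R) (N0 : nat) :
  (0 < s)%N -> (forall k, (k < s)%N -> 0 < g k) -> 0 < eps ->
  exists (M : nat) (g' : nat -> R),
  [/\ forall k, (k < s)%N -> g' k = g k, forall k, 0 < g' k,
    \sum_(i < M) (g' (s + i)%N)^-1 * (\sum_(j < s + i) g' j / (s + i - j)`!%:R) <= eps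
    & block_good s M N0 g' eps].
Proof.
move=> s0 g0 eps0.
have e0 : 0 < Order.min eps 1 by rewrite lt_min eps0/=.
have e1 : Order.min eps 1 <= 1 by rewrite ge_min lexx orbT.
have e2 : Order.min eps 1 <= eps by rewrite ge_min lexx.
have [M [g' [h1 h2 h3 [N N0N h4]]]] := block_le1 N0 s0 g0 e0 e1.
exists M, g'; split => //; first exact: le_trans h3 e2.
exists N => // m ms; have [f [f1 f2 f3 f4]] := h4 m ms; exists f; split=> //.
- exact: le_trans f2 e2.
- by apply: le_trans f3 _; rewrite ler_wpM2r.
- exact: le_trans f4 e2.
Qed.

(** * The Hahn-Banach theorem *)

Section Scalar.
Variables (K : fieldType) (V : lmodType K) (f : V -> K).
Hypothesis fP : scalar f.

Lemma scalar_fun0 : f 0 = 0.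
Proof. by have := fP (-1) 0 0; rewrite scaler0 addr0 mulN1r addNr. Qed.

Lemma scalar_funD x y : f (x + y) = f x + f y.
Proof. by have := fP 1 x y; rewrite scale1r mul1r. Qed.

Lemma scalar_funZ a x : f (a *: x) = a * f x.
Proof. by have := fP a x 0; rewrite !addr0 scalar_fun0 addr0. Qed.

Lemma scalar_funN x : f (- x) = - f x.
Proof. by rewrite -scaleN1r scalar_funZ mulN1r. Qed.

Lemma scalar_funB x y : f (x - y) = f x - f y.
Proof. by rewrite scalar_funD scalar_funN. Qed.

Lemma scalar_fun_sum n (F : 'I_n -> V) : f (\sum_(i < n) F i) = \sum_(i < n) f (F i).
Proof. exact: (big_morph f scalar_funD scalar_fun0). Qed.

End Scalar.

(* The common interface to the two scalar fields R and R[i]. *)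
Record real_part (R : realType) (K : numFieldType) := RealPart {
  inc : {rmorphism R -> K};
  re : K -> R;
  incK : cancel inc re;
  reK : forall x, 0 <= x -> inc (re x) = x;
  ler_inc : {mono inc : x y / x <= y}
}.

Section RealPart.
Variables (R : realType) (K : numFieldType) (S : real_part R K).
Local Notation inc := (inc S).
Local Notation re := (re S).

Lemma ltr_inc : {mono inc : x y / x < y}.
Proof. by move=> x y; rewrite !lt_def (ler_inc S) (can_eq (incK S)). Qed.

Lemma inc_ge0 r : (0 <= inc r) = (0 <= r).
Proof. by rewrite -(rmorph0 inc) (ler_inc S). Qed.

Lemma inc_gt0 r : (0 < inc r) = (0 < r).
Proof. by rewrite -(rmorph0 inc) ltr_inc. Qed.

Lemma re_le x y : 0 <= x -> 0 <= y -> (re x <= re y) = (x <= y).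
Proof. by move=> x0 y0; rewrite -(ler_inc S) !reK. Qed.

Lemma re_ge0 x : 0 <= x -> 0 <= re x.
Proof. by move=> x0; rewrite -(ler_inc S) rmorph0 reK. Qed.

Lemma re0 : re 0 = 0.
Proof. by rewrite -(rmorph0 inc) incK. Qed.

Lemma re1 : re 1 = 1.
Proof. by rewrite -(rmorph1 inc) incK. Qed.

Lemma reD x y : 0 <= x -> 0 <= y -> re (x + y) = re x + re y.
Proof. by move=> x0 y0; rewrite -[RHS](incK S) rmorphD !reK. Qed.

Lemma reM x y : 0 <= x -> 0 <= y -> re (x * y) = re x * re y.
Proof. by move=> x0 y0; rewrite -[RHS](incK S) rmorphM !reK. Qed.

Lemma re_normD (V : normedZmodType K) (x y : V) : re `|x + y| <= re `|x| + re `|y|.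
Proof. by rewrite -reD// re_le ?addr_ge0// ler_normD. Qed.

Lemma re_norm_inc r : re `|inc r| = `|r|.
Proof.
have [r0|r0] := leP 0 r.
  by rewrite (ger0_norm r0) ger0_norm ?inc_ge0// incK.
rewrite (ltr0_norm r0) ltr0_norm; last by rewrite -(rmorph0 inc) ltr_inc.
by rewrite -rmorphN incK.
Qed.

Definition seminorm (V : lmodType K) (q : V -> R) :=
  (forall x y, q (x + y) <= q x + q y) /\
  (forall a x, q (a *: x) = re `|a| * q x).

(** Used with two seminorms: the norm gives norming functionals, the distance to a span gives
    functionals vanishing on it. *)
Definition hahn_banach := forall (V : lmodType K) (q : V -> R), seminorm q ->
  forall e : V, exists2 f : V -> K, scalar f &
    (forall x, re `|f x| <= q x) /\ f e = inc (q e).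

(** This stands for the local compactness of the scalar field and provides the finite nets of
    Mazur's argument. *)
Definition totally_bounded := forall (B d : R), 0 < d ->
  exists l : seq K, forall a : K, re `|a| <= B ->
    exists2 b, b \in l & re `|a - b| < d.

Section RealHahnBanach.
Variables (V : lmodType K) (q : V -> R).
Hypothesis qP : seminorm q.

Local Notation "t · x" := (inc t *: x) (at level 40).

Let qD x y : q (x + y) <= q x + q y. Proof. by case: qP. Qed.
Let qZ t x : q (t · x) = `|t| * q x.
Proof. by case: qP => _ ->; rewrite re_norm_inc. Qed.

Lemma seminorm0 : q 0 = 0.
Proof. by rewrite -(scale0r 0) -(rmorph0 inc) qZ normr0 mul0r. Qed.

Lemma seminormN x : q (- x) = q x.
Proof. by rewrite -scaleN1r -(rmorph1 inc) -rmorphN qZ normrN normr1 mul1r. Qed.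

Lemma seminorm_ge0 x : 0 <= q x.
Proof.
have := qD x (- x); rewrite subrr seminorm0 seminormN; lra.
Qed.

(** The graph of a partial real-linear functional below q. Being single-valued follows from
    domination ([dominated_fun]), and as a mere set of pairs the notion is stable under unions of
    chains. *)
Definition dominated (G : set (V * R)) :=
  (forall p p' t, G p -> G p' -> G (p.1 + t · p'.1, p.2 + t * p'.2)) /\
  (forall p, G p -> p.2 <= q p.1).

Lemma dominated_fun G x r s : dominated G -> G (x, r) -> G (x, s) -> r = s.
Proof.
move=> [GS Gq] xr xs.
have le r' s' : G (x, r') -> G (x, s') -> r' <= s'.
  move=> h1 h2; have := Gq _ (GS _ _ (-1) h1 h2).
  by rewrite /= rmorphN rmorph1 scaleN1r subrr seminorm0 mulN1r subr_le0.
by apply/eqP; rewrite eq_le !le.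
Qed.

Lemma dominated0 G p : dominated G -> G p -> G (0, 0).
Proof.
move=> [GS _] Gp; have := GS _ _ (-1) Gp Gp.
by rewrite rmorphN rmorph1 scaleN1r mulN1r !subrr.
Qed.

Lemma dominated_scale G p t : dominated G -> G p -> G (t · p.1, t * p.2).
Proof.
move=> dG Gp; have := dG.1 _ _ t (dominated0 dG Gp) Gp; by rewrite /= !add0r.
Qed.

(** The value c at x0 has to lie above every r - q (x - x0) and below every q (y + x0) - s.
    Subadditivity makes this possible, and c is the supremum of the former. *)
Lemma dominated_extend G (p0 : V * R) x0 : dominated G -> G p0 ->
  exists c, dominated [set p | exists t x r, [/\ G (x, r), p.1 = x + t · x0 & p.2 = r + t * c]].
Proof.
move=> dG Gp0; have [GS Gq] := dG.
pose A := [set a | exists x r, G (x, r) /\ a = r - q (x - x0)].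
have key x r y s : G (x, r) -> G (y, s) -> r - q (x - x0) <= q (y + x0) - s.
  move=> xr ys; have := Gq _ (GS _ _ 1 ys xr); rewrite /= rmorph1 scale1r mul1r.
  have -> : y + x = (y + x0) + (x - x0) by rewrite addrACA subrr addr0.
  by have := qD (y + x0) (x - x0); lra.
have A0 : A !=set0 by case: p0 Gp0 => x r Gp0; exists (r - q (x - x0)), x, r.
have ubA : has_ubound A.
  case: p0 Gp0 => y s Gp0; exists (q (y + x0) - s) => _ [x [r [xr ->]]]; exact: key.
pose c := sup A; exists c.
have cl x r : G (x, r) -> r - q (x - x0) <= c.
  by move=> xr; apply: ub_le_sup => //; exists x, r.
have cu x r : G (x, r) -> c <= q (x + x0) - r.
  move=> xr; apply: ge_sup => // _ [y [s [ys ->]]]; exact: key.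
split.
  move=> [_ _] [_ _] u [t [x [r [xr /= -> ->]]]] [t' [x' [r' [xr' /= -> ->]]]].
  exists (t + u * t'), (x + u · x'), (r + u * r'); split; first exact: (GS (x, r) (x', r')).
    by rewrite rmorphD rmorphM scalerDr scalerDl scalerA addrACA.
  by rewrite mulrDr mulrDl mulrA addrACA.
move=> [_ _] [t [x [r [xr /= -> ->]]]].
have [t0|t0|->] := ltgtP t 0; last first.
- by rewrite rmorph0 scale0r mul0r !addr0; apply: Gq xr.
- have := cu _ _ (dominated_scale t^-1 dG xr) => /= h.
  have -> : x + t · x0 = t · (t^-1 · x + x0).
    by rewrite scalerDr scalerA -rmorphM divff ?gt_eqF// rmorph1 scale1r.
  rewrite qZ gtr0_norm//; have := ler_wpM2l (ltW t0) h.
  by rewrite mulrBr mulrA divff ?gt_eqF// mul1r lerBrDr addrC.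
- have u0 : 0 < - t by rewrite oppr_gt0.
  have := cl _ _ (dominated_scale (- t)^-1 dG xr) => /= h.
  have -> : x + t · x0 = (- t) · ((- t)^-1 · x - x0).
    by rewrite scalerBr scalerA -rmorphM divff ?gt_eqF// rmorph1 scale1r rmorphN scaleNr opprK.
  rewrite qZ gtr0_norm//; have := ler_wpM2l (ltW u0) h.
  by rewrite mulrBr mulrA divff ?gt_eqF// mul1r mulNr; lra.
Qed.

Lemma real_hahn_banach (e : V) : exists u : V -> R,
  [/\ forall x y t, u (x + t · y) = u x + t * u y, forall x, u x <= q x & u e = q e].
Proof.
pose L0 := [set p : V * R | exists t, p = (t · e, t * q e)].
have dL0 : dominated L0.
  split=> [_ _ t [a ->] [b ->]|_ [t ->]] /=.
    by exists (a + t * b); rewrite scalerA -rmorphM -scalerDl -rmorphD mulrDl mulrA.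
  by rewrite qZ ler_wpM2r ?seminorm_ge0// ler_norm.
have L0e : L0 (e, q e) by exists 1; rewrite rmorph1 scale1r mul1r.
(* The last clause binds nonempty graphs only, because the union of the empty chain must belong to
   [P]. *)
pose P := [set G : set (V * R) | dominated G /\ (G !=set0 -> G (e, q e))].
have [|G [[dG Ge] Gmax]] := @Zorn_bigcup _ P.
  move=> F FP Ftot; split; first split.
  - move=> p p' t [A FA Ap] [B FB Bp'].
    have [AB|BA] := Ftot _ _ FA FB.
      by exists B => //; apply: (FP _ FB).1.1 => //; exact: AB.
    by exists A => //; apply: (FP _ FA).1.1 => //; exact: BA.
  - by move=> p [A FA Ap]; apply: (FP _ FA).1.2.
  - by move=> [p [A FA Ap]]; exists A => //; apply: (FP _ FA).2; exists p.
have {}Ge : G (e, q e).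
  apply: Ge; apply: contrapT => G0.
  apply: (Gmax L0) => //; split=> // [|h]; last by apply: G0; exists (e, q e); apply: h.
  by move=> p Gp; exfalso; apply: G0; exists p.
have tot x : exists r, G (x, r).
  apply: contrapT => nx.
  have [c dc] := dominated_extend x dG Ge; set G' := [set p | _] in dc.
  have sub : G `<=` G'.
    by move=> [y r] yr; exists 0, y, r; rewrite rmorph0 scale0r mul0r !addr0.
  apply: (Gmax G'); last by split=> // _; exact: sub.
  split=> // h; apply: nx; exists c; apply: h.
  by exists 1, 0, 0; split; [exact: dominated0 dG Ge | rewrite rmorph1 scale1r add0r | rewrite
    mul1r add0r].
have [u uP] := choice tot.
exists u; split.
- by move=> x y t; apply: (dominated_fun dG (uP _)); apply: (dG.1 _ _ t (uP x) (uP y)).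
- by move=> x; apply: dG.2 (uP x).
- exact: dominated_fun dG (uP _) Ge.
Qed.

End RealHahnBanach.
End RealPart.

Section RealScalars.
Variable R : realType.

Definition real_part_real : real_part R R :=
  @RealPart R R idfun idfun (fun=> erefl) (fun _ _ => erefl) (fun _ _ => erefl).

Lemma hahn_banach_real : hahn_banach real_part_real.
Proof.
move=> V q qP e; have [u [uS' uq ue]] := real_hahn_banach qP e.
have uS : forall x y (t : R), u (x + t *: y) = u x + t * u y := uS'.
exists u; first by move=> a x y; rewrite [a *: x + y]addrC uS addrC.
split=> // x; rewrite /= ler_norml uq andbT lerNl.
have u0 : u 0 = 0 by have := uS 0 0 (-1); rewrite scaler0 addr0 mulN1r subrr.
have := uq (- x); rewrite (seminormN qP); apply: le_trans.
by have := uS 0 x (-1); rewrite /= scaleN1r add0r u0 add0r mulN1r => ->.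
Qed.

Lemma totally_bounded_real : totally_bounded real_part_real.
Proof.
move=> B d d0; have [n nE] : exists n, n = (Num.truncn (2 * B / d)).+1 by eexists.
exists [seq - B + i%:R * d | i <- iota 0 n] => a /=; rewrite ler_norml => /andP[aB Ba].
have x0 : 0 <= (a + B) / d by rewrite divr_ge0 ?(ltW d0)//; lra.
have /andP[t1 t2] := truncn_itv x0.
set k := Num.truncn _ in t1 t2; exists (- B + k%:R * d).
  apply: (map_f (fun i : nat => - B + i%:R * d)); rewrite mem_iota add0n/= nE ltnS.
  apply: le_truncn; rewrite ler_wpM2r ?invr_ge0 ?(ltW d0)//; lra.
rewrite ler_pdivlMr// in t1; rewrite ltr_pdivrMr// -natr1 mulrDl mul1r in t2.
by rewrite ltr_norml; apply/andP; split; lra.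
Qed.

End RealScalars.

Section ComplexScalars.
Variable R : realType.
Local Notation C := R[i].
Local Notation Re := (@complex.Re R).
Local Notation Im := (@complex.Im R).
Local Notation "x %:C" := (@real_complex_def _ (Phant R) x) (at level 1, format "x %:C").

Lemma real_complexK : cancel (real_complex R) Re. Proof. by []. Qed.

Lemma Re_nonneg (x : C) : 0 <= x -> real_complex R (Re x) = x.
Proof. by case: x => a b; rewrite lecE/= => /andP[/eqP -> _]. Qed.

Lemma ler_real_complex : {mono real_complex R : x y / x <= y}.
Proof. by move=> x y; rewrite lecE/= eqxx. Qed.

Definition real_part_complex : real_part R C :=
  @RealPart R C (real_complex R) Re real_complexK Re_nonneg ler_real_complex.

Lemma Re_norm (z : C) : Re `|z| = Num.sqrt (Re z ^+ 2 + Im z ^+ 2).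
Proof. by rewrite normc_def. Qed.

Lemma ReM (x y : C) : Re (x * y) = Re x * Re y - Im x * Im y.
Proof. by case: x => a b; case: y => c d. Qed.

Lemma ImM (x y : C) : Im (x * y) = Re x * Im y + Im x * Re y.
Proof. by case: x => a b; case: y => c d. Qed.

Lemma ReD (x y : C) : Re (x + y) = Re x + Re y.
Proof. by case: x => a b; case: y => c d. Qed.

Lemma ImD (x y : C) : Im (x + y) = Im x + Im y.
Proof. by case: x => a b; case: y => c d. Qed.

(** The functional is f(x) = u(x) - i u(i x) for a real one u. Rotating x until f(x) is nonnegative
    carries domination over to |f|; at e, the real part q e and the bound |f(e)| <= q e leave no
    imaginary part. *)
Lemma hahn_banach_complex : hahn_banach real_part_complex.
Proof.
move=> V q qP e; have [u [uS' uq ue]] := real_hahn_banach qP e.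
have uS : forall x y t, u (x + real_complex R t *: y) = u x + t * u y := uS'.
have u0 : u 0 = 0 by have := uS 0 0 (-1); rewrite scaler0 addr0 mulN1r subrr.
have uD x y : u (x + y) = u x + u y.
  by have := uS x y 1; rewrite rmorph1 scale1r mul1r.
have uZ t x : u (real_complex R t *: x) = t * u x.
  by have := uS 0 x t; rewrite !add0r u0 add0r.
have uN x : u (- x) = - u x by have := uZ (-1) x; rewrite rmorphN1 scaleN1r mulN1r.
pose j : C := Complex 0 1.
pose f x : C := Complex (u x) (- u (j *: x)).
have zE (a : C) (x : V) : a *: x = real_complex R (Re a) *: x + real_complex R (Im a) *: (j *: x).
  rewrite scalerA -scalerDl; congr (_ *: _).
  by apply/eqP; rewrite eq_complex ReD ImD ReM ImM /=; apply/andP; split; apply/eqP; ring.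
have jj x : j *: (j *: x) = - x.
  rewrite scalerA -scaleN1r; congr (_ *: _).
  by apply/eqP; rewrite eq_complex ReM ImM /=; apply/andP; split; apply/eqP; ring.
have jZ t x : j *: (real_complex R t *: x) = real_complex R t *: (j *: x).
  by rewrite !scalerA mulrC.
have fP : scalar f.
  move=> a x y; apply/eqP; rewrite eq_complex ReD ImD ReM ImM /=.
  rewrite !uD scalerDr uD [a *: x]zE uD !uZ scalerDr uD.
  rewrite !jZ !uZ jj uN.
  by apply/andP; split; apply/eqP; ring.
have fle x : Re `|f x| <= q x.
  have [->|fx0] := eqVneq (f x) 0.
    by rewrite normr0 (seminorm_ge0 qP).
  pose c := `|f x| / f x.
  have c1 : `|c| = 1 by rewrite normrM normfV normr_id divff// normr_eq0.
  have fc : f (c *: x) = `|f x| by rewrite (scalar_funZ fP) divfK.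
  have -> : Re `|f x| = u (c *: x) by rewrite -fc.
  apply: le_trans (uq _) _; case: qP => _ qZ.
  by rewrite qZ c1 /= mul1r.
exists f => //; split=> //.
have := fle e; have qe := seminorm_ge0 qP e.
rewrite Re_norm /= ue => h.
have : Num.sqrt (q e ^+ 2 + (- u (j *: e)) ^+ 2) ^+ 2 <= q e ^+ 2.
  by rewrite lerXn2r ?nnegrE ?sqrtr_ge0.
rewrite sqr_sqrtr ?addr_ge0 ?sqr_ge0// gerDl => h2.
have : (- u (j *: e)) ^+ 2 = 0 by apply/eqP; rewrite eq_le h2 sqr_ge0.
by move/eqP; rewrite sqrf_eq0 => /eqP h3; rewrite /f h3 ue.
Qed.

Lemma Re_norm_le (a b : R) : Re `|Complex a b : C| <= `|a| + `|b|.
Proof.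
rewrite Re_norm /= -[leRHS]ger0_norm ?addr_ge0// -sqrtr_sqr ler_sqrt ?sqr_ge0//.
by rewrite sqrrD !real_normK ?num_real// addrAC lerDl mulrn_wge0// mulr_ge0.
Qed.

Lemma totally_bounded_complex : totally_bounded real_part_complex.
Proof.
move=> B d d0; have [l lP] := @totally_bounded_real R B (d / 2) (divr_gt0 d0 (ltr0Sn _ 1)).
exists [seq Complex x y | x <- l, y <- l] => -[a b].
have -> : re real_part_complex `|Complex a b| = Num.sqrt (a ^+ 2 + b ^+ 2) by exact: Re_norm.
move=> abB.
have aB : `|a| <= B.
  by apply: le_trans abB; rewrite -sqrtr_sqr ler_wsqrtr// lerDl sqr_ge0.
have bB : `|b| <= B.
  by apply: le_trans abB; rewrite -sqrtr_sqr ler_wsqrtr// lerDr sqr_ge0.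
have [x xl /= xd] := lP a aB; have [y yl /= yd] := lP b bB.
exists (Complex x y); first by apply/allpairsP; exists (x, y).
by have := Re_norm_le (a - x) (b - y) => /le_lt_trans; apply; lra.
Qed.

End ComplexScalars.

(** * Biorthogonal systems *)

Section Norm.
Variables (R : realType) (K : numFieldType) (S : real_part R K).
Variable X : normedModType K.
Local Notation inc := (inc S).
Local Notation re := (re S).
Implicit Types x y z : X.

Definition nrm x : R := re `|x|.

Lemma nrm_ge0 x : 0 <= nrm x.
Proof. exact: re_ge0. Qed.

Lemma nrm0 : nrm 0 = 0.
Proof. by rewrite /nrm normr0 re0. Qed.

Lemma nrmD x y : nrm (x + y) <= nrm x + nrm y.
Proof. exact: re_normD. Qed.

Lemma nrmN x : nrm (- x) = nrm x.
Proof. by rewrite /nrm normrN. Qed.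

Lemma nrmB x y : nrm (x - y) = nrm (y - x).
Proof. by rewrite /nrm distrC. Qed.

Lemma nrmZ a x : nrm (a *: x) = re `|a| * nrm x.
Proof. by rewrite /nrm normrZ reM. Qed.

Lemma nrm_incZ r x : nrm (inc r *: x) = `|r| * nrm x.
Proof. by rewrite nrmZ re_norm_inc. Qed.

Lemma nrm_eq0 x : (nrm x == 0) = (x == 0).
Proof.
apply/eqP/eqP => [|->]; last exact: nrm0.
by move/(congr1 inc); rewrite reK// rmorph0 => /normr0P/eqP.
Qed.

Lemma nrm_gt0 x : (0 < nrm x) = (x != 0).
Proof. by rewrite lt_def nrm_ge0 andbT nrm_eq0. Qed.

Lemma nrm_seminorm : seminorm S nrm.
Proof. by split; [exact: nrmD|exact: nrmZ]. Qed.

Lemma nrm_sum n (F : 'I_n -> X) : nrm (\sum_(i < n) F i) <= \sum_(i < n) nrm (F i).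
Proof.
elim/big_ind2: _ => [|x a y b xa yb|//]; first by rewrite nrm0.
exact: le_trans (nrmD _ _) (lerD xa yb).
Qed.

Definition in_span (s : nat) (b : nat -> X) x :=
  exists c : nat -> K, x = \sum_(i < s) c i *: b i.

Lemma in_span0 s b : in_span s b 0.
Proof. by exists (fun=> 0); rewrite big1// => i _; rewrite scale0r. Qed.

Lemma in_spanD s b x y : in_span s b x -> in_span s b y -> in_span s b (x + y).
Proof.
move=> [c ->] [d ->]; exists (fun i => c i + d i); rewrite -big_split/=.
by apply: eq_bigr => i _; rewrite scalerDl.
Qed.

Lemma in_spanZ s b a x : in_span s b x -> in_span s b (a *: x).
Proof.
move=> [c ->]; exists (fun i => a * c i); rewrite scaler_sumr.
by apply: eq_bigr => i _; rewrite scalerA.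
Qed.

(** Otherwise the common kernel is finitely spanned; each functional that is dropped enlarges the
    kernel by at most one dimension, so in the end X would be finitely spanned. *)
Lemma kernel_nontrivial (n : nat) (f : nat -> X -> K) : infinite_dimensional X ->
  (forall i, (i < n)%N -> scalar (f i)) ->
  exists2 e, e != 0 & forall i, (i < n)%N -> f i e = 0.
Proof.
move=> infX fP; apply: contrapT => noe; apply: infX.
have: exists m v, forall x, (forall i, (i < n)%N -> f i x = 0) -> in_span m v x.
  exists 0%N, (fun=> 0) => x x0; have [->|xn0] := eqVneq x 0; first exact: in_span0.
  by exfalso; apply: noe; exists x.
elim: n fP {noe} => [|n IH] fP [m [v vP]].
  exists m, (fun i => v i) => x; have [|c cP] := vP x; first by [].
  by exists (fun i => c i).
apply: IH; first by move=> i /ltnW/fP.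
have [[z [z0 fz]]|nz] := pselect (exists z, (forall i, (i < n)%N -> f i z = 0) /\ f n z != 0);
  last first.
  exists m, v => x xn; apply: vP => i; rewrite ltnS leq_eqVlt => /orP[/eqP ->|/xn//].
  by apply: contrapT => /eqP fx; apply: nz; exists x.
exists m.+1, (fun i => if i == m then z else v i) => x xn.
have [|c cP] := vP (x - (f n x / f n z) *: z).
  move=> i; rewrite ltnS leq_eqVlt => /orP[/eqP ->|hi].
    by rewrite (scalar_funB (fP _ _))// (scalar_funZ (fP _ _))// divfK// subrr.
  by rewrite (scalar_funB (fP _ _)) ?leqW// (scalar_funZ (fP _ _)) ?leqW// (xn i)// (z0 i)//
    mulr0 subrr.
exists (fun i => if i == m then f n x / f n z else c i).
rewrite big_ord_recr/= eqxx -[LHS](subrK ((f n x / f n z) *: z)) cP; congr (_ + _).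
by apply: eq_bigr => i _; rewrite ltn_eqF.
Qed.

(** Sequences are infinite even for finite systems: [biorth s] constrains the entries below s only,
    so extending a system means overwriting entry s, and the limit of the construction has the same
    type. [bC] holds bounds for the norms of the functionals. *)
Record bsys := Bsys { bv : nat -> X; bf : nat -> X -> K; bC : nat -> R }.

Definition bounded_functional (f : X -> K) (C : R) :=
  scalar f /\ forall x, re `|f x| <= C * nrm x.

Lemma bounded_functional_ge0 f C e : bounded_functional f C -> f e != 0 -> 0 <= C.
Proof.
move=> [fS fC] fe; have e0 : e != 0.
  by apply: contraNneq fe => ->; rewrite (scalar_fun0 fS).
have ne : 0 < nrm e by rewrite nrm_gt0.
by rewrite -(pmulr_lge0 _ ne) (le_trans _ (fC e))// re_ge0.
Qed.

Definition biorth (s : nat) (B : bsys) :=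
  (forall i, (i < s)%N -> bounded_functional (bf B i) (bC B i)) /\
  forall i j, (i < s)%N -> (j < s)%N -> bf B i (bv B j) = (i == j)%:R.

Lemma biorth_coef s B (c : nat -> K) i : biorth s B -> (i < s)%N ->
  bf B i (\sum_(j < s) c j *: bv B j) = c i.
Proof.
move=> [fP fb] si; have [fS _] := fP i si.
rewrite (scalar_fun_sum fS) (bigD1 (Ordinal si))//= (scalar_funZ fS) fb// eqxx mulr1.
rewrite big1 ?addr0// => j ji; rewrite (scalar_funZ fS) fb//.
by rewrite [i == j](_ : _ = false) ?mulr0//; apply: contraNF ji => /eqP ij; apply/eqP/val_inj.
Qed.

Hypothesis HB : hahn_banach S.
Hypothesis TB : totally_bounded S.
Hypothesis infX : infinite_dimensional X.

Lemma finite_net (b : nat -> X) (Bd : nat -> R) k d : 0 < d ->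
  exists l : seq X, forall c : nat -> K, (forall i, (i < k)%N -> re `|c i| <= Bd i) ->
    exists2 z, z \in l & nrm (\sum_(i < k) c i *: b i - z) < d.
Proof.
elim: k d => [|k IH] d d0.
  by exists [:: 0] => c _; exists 0; rewrite ?inE// big_ord0 subrr nrm0.
have [l lP] := IH (d / 2) (divr_gt0 d0 (ltr0Sn _ 1)).
have nb : 0 < nrm (b k) + 1 by have := nrm_ge0 (b k); lra.
have [g gP] := TB (Bd k) (divr_gt0 (divr_gt0 d0 (ltr0Sn _ 1)) nb).
exists [seq z + a *: b k | z <- l, a <- g] => c cB.
have [z zl zd] := lP c (fun i hi => cB i (ltnW hi)).
have [a ag ad] := gP (c k) (cB k (ltnSn k)).
exists (z + a *: b k); first by apply/allpairsP; exists (z, a).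
rewrite big_ord_recr/= opprD addrACA -scalerBl.
apply: le_lt_trans (nrmD _ _) _; rewrite nrmZ [ltRHS](splitr d).
apply: ltr_leD => //; apply: (@le_trans _ _ (re `|c k - a| * (nrm (b k) + 1))).
  by rewrite ler_wpM2l ?re_ge0// lerDl.
by rewrite -ler_pdivlMr// ltW.
Qed.

(** The functionals bound the coefficients of a unit vector, so finitely many balls of radius 1/8
    cover the unit sphere of the span. If u is in the ball around z and h norms z, then |h(u)| >=
    |z| - 1/8 >= 1 - 2/8 >= 1/2. *)
Lemma norming_functionals s B : biorth s B -> exists hs : seq (X -> K),
  (forall i, (i < size hs)%N -> bounded_functional (nth (fun=> 0) hs i) 1) /\
  forall y, in_span s (bv B) y ->
    exists2 i, (i < size hs)%N & nrm y <= 2 * re `|nth (fun=> 0) hs i y|.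
Proof.
move=> bi; have [fP fb] := bi.
have d8 : 0 < 1 / 8 :> R by lra.
have [l lP] := finite_net (bv B) (bC B) s d8.
have [|h hP] := @choice X (X -> K) (fun z f => scalar f /\ ((forall x, re `|f x| <= nrm x) /\ f z
  = inc (nrm z))).
  by move=> z; have [f fS fz] := HB nrm_seminorm z; exists f.
exists [seq h z | z <- l]; split.
  move=> i; rewrite size_map => il; rewrite (nth_map 0)//.
  by have [? [? _]] := hP (l`_i); split=> // x; rewrite mul1r.
move=> y [c yE].
have key u : in_span s (bv B) u -> nrm u = 1 -> exists2 z, z \in l & 1 <= 2 * re `|h z u|.
  move=> [a uE] u1; have [|z zl zd] := lP a.
    move=> i si; rewrite -(biorth_coef a bi si) -uE -[leRHS]mulr1 -u1.
    by have [_] := fP i si; apply.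
  exists z => //; rewrite -uE in zd.
  have [hS [hle hz]] := hP z.
  have z1 : 1 <= nrm z + nrm (u - z) by rewrite -u1 -[X in nrm X <= _](subrK z) addrC nrmD.
  have := hle (z - u); rewrite (scalar_funB hS) hz nrmB => hzu.
  have : nrm z <= re `|inc (nrm z) - h z u| + re `|h z u|.
    rewrite -[leLHS]ger0_norm ?nrm_ge0// -(re_norm_inc S) -[X in re `|X| <= _](subrK (h z u)).
    exact: re_normD.
  lra.
have [y0|y0] := eqVneq y 0.
  (* Even y = 0 needs an index, so the net must be nonempty: zero coefficients yield a member. *)
  have [|z zl _] := lP (fun=> 0).
    by move=> i si; rewrite normr0 re0 (bounded_functional_ge0 (fP i si) (_ : bf B i (bv B i) !=
      0))// fb// eqxx oner_eq0.
  exists (index z l); first by rewrite size_map index_mem.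
  by rewrite y0 nrm0 mulr_ge0// re_ge0.
have ny : 0 < nrm y by rewrite nrm_gt0.
have [||z zl hz] := key (inc (nrm y)^-1 *: y).
- by apply: in_spanZ; exists c.
- by rewrite nrm_incZ gtr0_norm ?invr_gt0// mulVf ?gt_eqF.
exists (index z l); first by rewrite size_map index_mem.
rewrite (nth_map 0) ?index_mem// nth_index//.
have [hS _] := hP z; move: hz; rewrite (scalar_funZ hS) normrM reM// re_norm_inc (gtr0_norm (_ :
  0 < (nrm y)^-1)) ?invr_gt0//.
by rewrite mulrCA [_^-1 * _]mulrC ler_pdivlMr// mul1r.
Qed.

Lemma dist_seminorm (s : nat) (b : nat -> X) : exists q : X -> R,
  [/\ seminorm S q, forall x, q x <= nrm x, forall y, in_span s b y -> q y = 0 &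
    forall x r, (forall y, in_span s b y -> r <= nrm (x - y)) -> r <= q x].
Proof.
pose D x := [set nrm (x - y) | y in in_span s b].
have D0 x : D x !=set0 by exists (nrm (x - 0)), 0 => //; exact: in_span0.
have lb x : has_lbound (D x) by exists 0 => _ [y _ <-]; exact: nrm_ge0.
pose q x := inf (D x).
have qle x y : in_span s b y -> q x <= nrm (x - y) by move=> ys; apply: ge_inf => //; exists y.
have qge x r : (forall y, in_span s b y -> r <= nrm (x - y)) -> r <= q x.
  by move=> h; apply: lb_le_inf => // _ [y ys <-]; exact: h.
have q0 x : 0 <= q x by apply: qge => y _; exact: nrm_ge0.
have qn x : q x <= nrm x by have := qle x 0 (in_span0 _ _); rewrite subr0.
have qs y : in_span s b y -> q y = 0.
  by move=> ys; apply/eqP; rewrite eq_le q0 andbT; have := qle y y ys; rewrite subrr nrm0.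
have qZ a x : q (a *: x) <= re `|a| * q x.
  have [->|a0] := eqVneq a 0.
    by rewrite scale0r normr0 re0 mul0r (qs _ (in_span0 _ _)).
  have ra : 0 < re `|a| by rewrite -(ltr_inc S) rmorph0 reK// normr_gt0.
  rewrite -ler_pdivrMl//; apply: qge => y ys; rewrite ler_pdivrMl//.
  by rewrite -nrmZ scalerBr; apply: qle; apply: in_spanZ.
exists q; split => //; split.
  move=> x y; rewrite -lerBlDl; apply: (qge) => z zs; rewrite lerBlDl -lerBlDr.
  apply: qge => w ws; rewrite lerBlDr.
  apply: (@le_trans _ _ (nrm (x + y - (w + z)))); first by apply: qle; apply: in_spanD.
  by rewrite opprD addrACA nrmD.
move=> a x; apply/eqP; rewrite eq_le qZ/=.
have [->|a0] := eqVneq a 0; first by rewrite normr0 re0 mul0r q0.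
have ra : 0 < re `|a| by rewrite -(ltr_inc S) rmorph0 reK// normr_gt0.
rewrite -ler_pdivlMl//; have := qZ a^-1 (a *: x).
rewrite scalerA mulVf// scale1r.
suff -> : re `|a^-1| = (re `|a|)^-1 by [].
by apply: (mulfI (lt0r_neq0 ra)); rewrite divff ?gt_eqF// -reM// -normrM divff// normr1 re1.
Qed.

Definition fresh (s : nat) (B : bsys) (e : X) (f : X -> K) :=
  [/\ f e = 1, forall i, (i < s)%N -> f (bv B i) = 0 &
      forall i, (i < s)%N -> bf B i e = 0].

(* Mazur's argument: a unit vector in the common kernel of functionals norming
   the span of the system up to a factor 2 is at distance at least 1/3 from it. *)
Lemma good_vector s B : biorth s B ->
  exists e f, [/\ nrm e = 1, bounded_functional f 3 & fresh s B e f].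
Proof.
move=> bi; have [fP fb] := bi.
have [hs [hB hN]] := norming_functionals bi.
pose F i := if (i < s)%N then bf B i else nth (fun=> 0) hs (i - s).
have [|e0 e00 eF] := @kernel_nontrivial (s + size hs) F infX.
  move=> i hi; rewrite /F; case: ltnP => si; first by have [] := fP i si.
  by have [|] := hB (i - s)%N; first by rewrite ltn_subLR.
pose e := inc (nrm e0)^-1 *: e0.
have ne0 : 0 < nrm e0 by rewrite nrm_gt0.
have e1 : nrm e = 1 by rewrite nrm_incZ gtr0_norm ?invr_gt0// mulVf ?gt_eqF.
have fe i : (i < s)%N -> bf B i e = 0.
  move=> si; have [fS _] := fP i si; rewrite (scalar_funZ fS).
  by have := eF i; rewrite /F si => ->; rewrite ?mulr0// ltn_addr.
have he i : (i < size hs)%N -> nth (fun=> 0) hs i e = 0.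
  move=> si; have [fS _] := hB i si; rewrite (scalar_funZ fS).
  have Fi : F (s + i)%N = nth (fun=> 0) hs i by rewrite /F ltnNge leq_addr/= addKn.
  by have := eF (s + i)%N; rewrite Fi ltn_add2l => ->; rewrite ?mulr0.
have [q [qP qle qs qge]] := dist_seminorm s (bv B).
(* Some h kills e and satisfies |y| <= 2 |h(y)| <= 2 |e - y|, whence 1 = |e| <= 3 |e - y|. *)
have q3 : 1 / 3 <= q e.
  apply: qge => y ys; have [i hi ny] := hN y ys.
  have [hS hle] := hB i hi.
  have := hle (e - y); rewrite (scalar_funB hS) he// sub0r normrN mul1r => h1.
  have := nrmD (e - y) y; rewrite subrK e1; lra.
have q0 : 0 < q e by lra.
have [f fS [fq fqe]] := HB qP e.
exists e, (fun x => inc (q e)^-1 * f x); split=> //.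
- split; first by move=> a x y; rewrite fS mulrDr mulrCA.
  move=> x; rewrite normrM reM// re_norm_inc (gtr0_norm (_ : 0 < (q e)^-1)) ?invr_gt0//.
  rewrite ler_pdivrMl//; apply: (le_trans (fq x)); apply: (le_trans (qle x)).
  by have := nrm_ge0 x; nra.
- split=> //; first by rewrite fqe -rmorphM mulVf ?gt_eqF// rmorph1.
  move=> i si; have : re `|f (bv B i)| <= 0.
    rewrite -(qs (bv B i)) ?fq//; exists (fun j => (j == i)%:R).
    rewrite (bigD1 (Ordinal si))//= eqxx scale1r big1 ?addr0// => j ji.
    by rewrite [(j : nat) == i](_ : _ = false) ?scale0r//; apply: contraNF ji => /eqP ij;
      apply/eqP/val_inj.
  rewrite -(re0 S) re_le// normr_le0 => /eqP ->; by rewrite mulr0.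
Qed.

(** The new vector is the remainder of x after subtracting its expansion, and its functional is a
    norming one corrected to vanish on the system, with no control on C. If the remainder is 0, any
    good vector does, with coefficient 0. *)
Lemma spanning_vector s B x : biorth s B ->
  exists e f C, [/\ bounded_functional f C, fresh s B e f &
    exists c : K, in_span s (bv B) (x - c *: e)].
Proof.
move=> bi; have [fP fb] := bi.
pose p := \sum_(i < s) bf B i x *: bv B i; pose r := x - p.
have [r0|r0] := eqVneq r 0.
  have [e [f [_ ef ee]]] := good_vector bi; exists e, f, 3; split=> //.
  exists 0; rewrite scale0r subr0; exists (fun i => bf B i x).
  by apply/eqP; rewrite -subr_eq0; apply/eqP.
have [f fS [fle fr]] := HB nrm_seminorm r.
have nr : 0 < nrm r by rewrite nrm_gt0.
pose g y := inc (nrm r)^-1 * f y; pose h y := g y - \sum_(i < s) g (bv B i) * bf B i y.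
have gS : scalar g by move=> a u v; rewrite /g fS mulrDr mulrCA.
have gr : g r = 1 by rewrite /g fr -rmorphM mulVf ?gt_eqF// rmorph1.
have br i : (i < s)%N -> bf B i r = 0.
  by move=> si; rewrite /r (scalar_funB (fP i si).1) (biorth_coef (fun j => bf B j x) bi si) subrr.
exists r, h, ((nrm r)^-1 + \sum_(i < s) re `|g (bv B i)| * bC B i); split.
- split.
    move=> a u v; rewrite /h gS mulrBr addrACA -opprD; congr (_ - _).
    rewrite mulr_sumr -big_split/=; apply: eq_bigr => i _.
    by rewrite (fP i (ltn_ord i)).1 mulrDr mulrCA.
  move=> y; apply: le_trans (re_normD _ _ _) _; rewrite normrN mulrDl; apply: lerD.
    by rewrite /g normrM reM// re_norm_inc (gtr0_norm (_ : 0 < (nrm r)^-1)) ?invr_gt0//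
      ler_wpM2l// invr_ge0 nrm_ge0.
  rewrite mulr_suml; elim/big_ind2: _ => [|u a v b ua vb|i _].
  + by rewrite normr0 re0.
  + exact: le_trans (re_normD _ _ _) (lerD ua vb).
  + rewrite normrM reM// -mulrA ler_wpM2l ?re_ge0//.
    by have [_] := fP i (ltn_ord i); apply.
- split=> //.
    by rewrite /h gr big1 ?subr0// => i _; rewrite br ?mulr0.
  move=> i si; rewrite /h (bigD1 (Ordinal si))//= fb// eqxx mulr1 big1 ?addr0 ?subrr// => j ji.
  by rewrite fb// [(j : nat) == i](_ : _ = false) ?mulr0//; apply: contraNF ji => /eqP ij;
    apply/eqP/val_inj.
- by exists 1; rewrite scale1r /r subKr; exists (fun i => bf B i x).
Qed.

End Norm.

(** * Inductive construction of the system *)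

Section Stages.
Variables (R : realType) (K : numFieldType) (S : real_part R K).
Variable X : normedModType K.
Local Notation inc := (inc S).
Local Notation re := (re S).
Local Notation nrm := (@nrm R K S X).
Local Notation bsys := (bsys R X).
Local Notation biorth := (@biorth R K S X).
Hypothesis HB : hahn_banach S.
Hypothesis TB : totally_bounded S.
Hypothesis infX : infinite_dimensional X.

(* If [b n] stands for t^n/n!, this is (t + 1)^n/n! - t^n/n!. *)
Definition taylor_vec (b : nat -> X) n := \sum_(j < n) inc (n - j)`!%:R^-1 *: b j.

Definition agree s (B B' : bsys) := forall i, (i < s)%N ->
  [/\ bv B' i = bv B i, bf B' i = bf B i & bC B' i = bC B i].

Lemma agree_trans s s' B B' B'' : (s <= s')%N ->
  agree s B B' -> agree s' B' B'' -> agree s B B''.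
Proof.
move=> ss h h' i si; have [-> -> ->] := h' i (leq_trans si ss); exact: h.
Qed.

(** Scaling e by g divides its functional by g. This freedom realizes prescribed weights and
    compensates a large C. *)
Lemma extend_fresh s B e f C g : biorth s B -> bounded_functional S f C -> fresh s B e f ->
  0 < g -> exists B', [/\ agree s B B', biorth s.+1 B', bv B' s = inc g *: e & bC B' s = C / g].
Proof.
move=> [fP fb] [fS fC] [fe1 feb fbe] g0.
pose f' x := inc g^-1 * f x.
exists (Bsys (fun i => if i == s then inc g *: e else bv B i)
  (fun i => if i == s then f' else bf B i) (fun i => if i == s then C / g else bC B i)).
split; rewrite /= ?eqxx//.
  by move=> i si /=; rewrite ltn_eqF.
split=> [i|i j]; rewrite ltnS leq_eqVlt => /orP[/eqP ->|si].
- rewrite /= eqxx; split; first by move=> a x y; rewrite /f' fS mulrDr mulrCA.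
  move=> x; rewrite /f' normrM reM// re_norm_inc (gtr0_norm (_ : 0 < g^-1)) ?invr_gt0//.
  by rewrite mulrAC [leRHS]mulrC ler_wpM2l ?invr_ge0 ?(ltW g0).
- by rewrite /= (ltn_eqF si); apply: fP.
- rewrite ltnS leq_eqVlt => /orP[/eqP ->|sj] /=; rewrite eqxx.
    by rewrite /f' (scalar_funZ fS) fe1 mulr1 -rmorphM mulVf ?gt_eqF// rmorph1.
  by rewrite ltn_eqF// gtn_eqF// /f' feb// mulr0.
- rewrite ltnS leq_eqVlt => /orP[/eqP ->|sj] /=.
    by rewrite eqxx ltn_eqF// (scalar_funZ (fP i si).1) fbe// mulr0.
  by rewrite (ltn_eqF si) (ltn_eqF sj) fb.
Qed.

Lemma extend_good s B (g : nat -> R) M : biorth s B -> (forall k, 0 < g k) ->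
  exists B', [/\ agree s B B', biorth (s + M) B' &
    forall i, (i < M)%N -> nrm (bv B' (s + i)) = g (s + i)%N /\ bC B' (s + i) = 3 / g (s + i)%N].
Proof.
move=> bi g0; elim: M => [|M [B' [h1 h2 h3]]].
  by exists B; rewrite addn0; split=> // i.
have [e [f [e1 fB ef]]] := good_vector HB TB infX h2.
have [B'' [k1 k2 k3 k4]] := extend_fresh h2 fB ef (g0 (s + M)%N).
exists B''; split.
- by apply: agree_trans h1 k1; rewrite leq_addr.
- by rewrite addnS.
- move=> i; rewrite ltnS leq_eqVlt => /orP[/eqP ->|iM].
    by rewrite k3 k4 nrm_incZ e1 mulr1 gtr0_norm.
  have [|-> _ ->] := k1 (s + i)%N; first by rewrite ltn_add2l.
  exact: h3.
Qed.

Lemma eq_taylor_vec (b b' : nat -> X) n : (forall i, (i < n)%N -> b' i = b i) ->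
  taylor_vec b' n = taylor_vec b n.
Proof. by move=> h; apply: eq_bigr => j _; rewrite h. Qed.

Lemma nrm_taylor_vec (b : nat -> X) n :
  nrm (taylor_vec b n) <= \sum_(j < n) nrm (b j) / (n - j)`!%:R.
Proof.
apply: le_trans (nrm_sum _ _) _; apply: ler_sum => j _.
by rewrite nrm_incZ ger0_norm ?invr_ge0// mulrC.
Qed.

Lemma eq_wnorm (g g' : nat -> R) n f x : (forall i, (i < n)%N -> g' i = g i) ->
  wnorm g' n f x = wnorm g n f x.
Proof. by move=> h; apply: eq_bigr => j _; rewrite h. Qed.

Lemma eq_block_good s M N0 (g g' : nat -> R) eps : (forall i, (i < s + M)%N -> g' i = g i) ->
  block_good s M N0 g eps -> block_good s M N0 g' eps.
Proof.
move=> h [N N0N H]; exists N => // m ms; have [f [f1 f2 f3 f4]] := H m ms.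
exists f; split; rewrite ?(eq_wnorm _ _ h)//.
by under eq_bigr do rewrite (eq_wnorm _ _ h).
Qed.

Lemma in_span_le s s' (b : nat -> X) x : (s <= s')%N -> in_span s b x -> in_span s' b x.
Proof.
move=> ss [c ->]; exists (fun i => if (i < s)%N then c i else 0).
rewrite (big_ord_widen _ (fun i => c i *: b i) ss) big_mkcond.
by apply: eq_bigr => i _; case: ifP => // _; rewrite scale0r.
Qed.

Lemma eq_in_span s (b b' : nat -> X) x : (forall i, (i < s)%N -> b' i = b i) ->
  in_span s b x -> in_span s b' x.
Proof. by move=> h [c ->]; exists c; apply: eq_bigr => i _; rewrite h. Qed.

Lemma biorth_nrm_gt0 s B i : biorth s B -> (i < s)%N -> 0 < nrm (bv B i).
Proof.
move=> [fP fb] si; rewrite nrm_gt0; apply: contra_eq_neq (fb i i si si) => ->.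
by rewrite (scalar_fun0 (fP i si).1) eqxx eq_sym oner_eq0.
Qed.

Definition stage s (B : bsys) (x : X) (eps : R) (N0 : nat) s' (B' : bsys) :=
  [/\ agree s B B', biorth s' B', in_span s' (bv B') x,
    \sum_(s <= n < s') bC B' n * nrm (taylor_vec (bv B') n) <= eps &
    exists2 M, s' = (s + M.+1)%N & block_good s M.+1 N0 (fun k => nrm (bv B' k)) eps].

(** A first vector brings x into the span. As [taylor_vec] at s involves earlier vectors only, a
    large scale [g0] makes its contribution at most eps/2 whatever C is. The block then follows with
    eps/6, because its functionals have bounds 3/g. *)
Lemma stage_exists s B x eps N0 : biorth s B -> 0 < eps ->
  exists s' B', stage s B x eps N0 s' B'.
Proof.
move=> bi e0.
have [e [f [C [fB ef [a ax]]]]] := spanning_vector HB TB infX x bi.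
have C0 : 0 <= C.
  by apply: (bounded_functional_ge0 fB (_ : f e != 0)); case: ef => -> _ _; exact: oner_neq0.
pose t := nrm (taylor_vec (bv B) s); have t0 : 0 <= t by exact: nrm_ge0.
pose g0 := C * t * 2 / eps + 1.
have g00 : 0 < g0 by rewrite ltr_wpDl// divr_ge0 ?mulr_ge0// ltW.
have [B1 [h1 h2 h3 h4]] := extend_fresh bi fB ef g00.
have [M [g' [g1 g2 g3 g4]]] := @block R s.+1 (fun k => nrm (bv B1 k)) (eps / 6) N0 (ltn0Sn s)
  (fun k => @biorth_nrm_gt0 s.+1 B1 k h2) (divr_gt0 e0 (ltr0Sn _ 5)).
have [B2 [k1 k2 k3]] := extend_good M h2 g2.
have gE i : (i < s.+1 + M)%N -> nrm (bv B2 i) = g' i.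
  have [si|si] := ltnP i s.+1; first by have [-> _ _] := k1 i si; rewrite g1.
  by rewrite -{1}(subnKC si) ltn_add2l => /k3[]; rewrite subnKC.
have ag : agree s B B2 by apply: agree_trans h1 k1.
have e0' : inc g0 != 0 by rewrite -(rmorph0 inc) (can_eq (incK S)) gt_eqF.
exists (s.+1 + M)%N, B2; split=> //.
- apply: (@in_span_le s.+1); first by rewrite leq_addr.
  have -> : x = (x - a *: e) + a *: e by rewrite subrK.
  apply: in_spanD.
    apply: (@in_span_le s) => //; apply: eq_in_span ax => i si.
    by have [] := ag i si.
  exists (fun i => if i == s then a / inc g0 else 0).
  rewrite big_ord_recr/= eqxx big1 ?add0r; last by move=> i _; rewrite ltn_eqF// scale0r.
  by have [-> _ _] := k1 s (ltnSn s); rewrite h3 scalerA divfK.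
- rewrite big_ltn ?leq_addr//; have -> : eps = eps / 2 + eps / 2 by rewrite -splitr.
  apply: lerD.
    have [_ _ ->] := k1 s (ltnSn s); rewrite h4.
    rewrite (eq_taylor_vec (b := bv B)); last by move=> i si; have [] := ag i si.
    rewrite -/t mulrAC ler_pdivrMr// /g0 mulrDr mulr1.
    have -> : eps / 2 * (C * t * 2 / eps) = C * t by field; rewrite gt_eqF.
    by rewrite lerDl divr_ge0// ltW.
  rewrite -{1}[s.+1]add0n [(s.+1 + M)%N]addnC big_addn addnK big_mkord.
  apply: (@le_trans _ _ (3 * \sum_(i < M) (g' (s.+1 + i)%N)^-1 *
     (\sum_(j < s.+1 + i) g' j / (s.+1 + i - j)`!%:R))); last by lra.
  rewrite mulr_sumr; apply: ler_sum => i _; rewrite addnC.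
  have [_ ->] := k3 i (ltn_ord i); rewrite -mulrA ler_wpM2l// ler_wpM2l//.
    by rewrite invr_ge0 ltW.
  apply: le_trans (nrm_taylor_vec _ _) _; apply: ler_sum => j _.
  by rewrite gE// (ltn_trans (ltn_ord j))// ltn_add2l.
(* The block starts at s.+1; read from s with length M.+1, it counts the spanning vector as new and
   approximates only the vectors before it. *)
- exists M; first by rewrite addSnnS.
  have [N N0N HN] := g4; exists N => // m ms.
  have [fm [f1 f2 f3 f4]] := HN m (leqW ms); rewrite addSnnS in gE f1 f2 f3 f4.
  have le6 : eps / 6 <= eps by lra.
  exists fm; split; rewrite ?(eq_wnorm _ _ gE)//.
  + exact: le_trans f2 le6.
  + under eq_bigr do rewrite (eq_wnorm _ _ gE).
    by apply: le_trans f3 _; rewrite ler_wpM2r.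
  + exact: le_trans f4 le6.
Qed.

Lemma biorth_agree s B B' : agree s B B' -> biorth s B -> biorth s B'.
Proof.
move=> h [fP fb]; split=> [i si|i j si sj]; have [Ev Ef EC] := h i si.
  by rewrite Ef EC; apply: fP.
by have [Ev' _ _] := h j sj; rewrite Ef Ev' fb.
Qed.

(* The sequence obtained by iterating the stages; [bv B n] plays the role of
   the monomial t^n/n!. *)
Lemma taylor_basis s0 B0 (d : nat -> X) : biorth s0 B0 ->
  exists B : bsys,
  [/\ agree s0 B0 B, forall s, biorth s B, forall j, exists s, in_span s (bv B) (d j),
    exists A, forall m, \sum_(0 <= n < m) bC B n * nrm (taylor_vec (bv B) n) <= A &
    forall j, exists s M, (j <= s)%N /\
      block_good s M j (fun k => nrm (bv B k)) ((1 / 2) ^+ j)].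
Proof.
move=> bi0.
pose ST := {p : nat * bsys | biorth p.1 p.2}.
have step (jp : nat * ST) : exists q : ST, stage (sval jp.2).1 (sval jp.2).2 (d jp.1) ((1 / 2) ^+
  jp.1) jp.1 (sval q).1 (sval q).2.
  case: jp => j [[s B] /= bi].
  have [|s' [B' st]] := @stage_exists s B (d j) ((1 / 2) ^+ j) j bi;
    first by rewrite exprn_gt0//; lra.
  have bi' : biorth s' B' by case: st.
  by exists (exist _ (s', B') bi').
have [nxt nxtP] := choice step.
pose st := fix st n : ST := if n is m.+1 then nxt (m, st m) else exist _ (s0, B0) bi0.
pose s n := (sval (st n)).1; pose B n := (sval (st n)).2.
have stP n : stage (s n) (B n) (d n) ((1 / 2) ^+ n) n (s n.+1) (B n.+1) := nxtP (n, st n).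
have sS n : (s n < s n.+1)%N by have [_ _ _ _ [M -> _]] := stP n; rewrite addnS ltnS leq_addr.
have smono m n : (m <= n)%N -> (s m <= s n)%N.
  exact: (@homo_leq _ s leq leqnn leq_trans (fun k => ltnW (sS k))).
have sge n : (n <= s n)%N by elim: n => // n IH; exact: leq_ltn_trans IH (sS n).
have agB m n : (m <= n)%N -> agree (s m) (B m) (B n).
  elim: n => [|n IH]; first by rewrite leqn0 => /eqP ->; move=> i.
  rewrite leq_eqVlt => /orP[/eqP ->|mn]; first by move=> i.
  have [h _ _ _ _] := stP n.
  by apply: agree_trans (IH mn) h; exact: smono.
pose Bi := Bsys (fun i => bv (B i.+1) i) (fun i => bf (B i.+1) i) (fun i => bC (B i.+1) i).
have agi n : agree (s n) (B n) Bi.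
  move=> i si /=; have [h|h] := leqP n i.+1.
    exact: (agB n i.+1 h i si).
  have [|<- <- <-//] := agB i.+1 n (ltnW h) i.
  exact: leq_trans (ltnSn i) (sge _).
have bis n : biorth n Bi.
  have : biorth (s n) Bi by apply: biorth_agree (agi n) _; exact: (svalP (st n)).
  move=> [fP fb]; split=> [i ni|i j ni nj]; [apply: fP|apply: fb];
    exact: leq_trans (sge n).
have C0 n : 0 <= bC Bi n.
  have [fP fb] := bis n.+1; apply: (bounded_functional_ge0 (fP n (ltnSn n)) (_ : bf Bi n (bv Bi
    n) != 0)).
  by rewrite fb ?eqxx ?oner_eq0.
exists Bi; split=> //.
- exact: (agi 0%N).
- move=> j; exists (s j.+1); have [_ _ h _ _] := stP j.
  by apply: eq_in_span h => i si; have [] := agi j.+1 i si.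
- pose a n := bC Bi n * nrm (taylor_vec (bv Bi) n).
  have a0 n : 0 <= a n by rewrite mulr_ge0// nrm_ge0.
  exists (\sum_(0 <= n < s 0) a n + 2) => m.
  have H n : \sum_(0 <= k < s n) a k <= \sum_(0 <= k < s 0) a k + \sum_(i < n) (1 / 2) ^+ i.
    elim: n => [|n IH]; first by rewrite big_ord0 addr0.
    rewrite (big_cat_nat _ (ltnW (sS n)))//= big_ord_recr/= addrA lerD//.
    have [_ _ _ h _] := stP n; apply: le_trans h.
    rewrite big_nat_cond [leRHS]big_nat_cond; apply: ler_sum => i /andP[/andP[_ si] _].
    have [_ _ EC] := agi n.+1 i si.
    rewrite /a EC (eq_taylor_vec (b := bv (B n.+1)))// => k ki.
    by have [] := agi n.+1 k (ltn_trans ki si).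
  apply: (@le_trans _ _ (\sum_(0 <= k < s m) a k)).
    rewrite [leRHS](big_cat_nat _ (sge m))//= lerDl.
    by apply: sumr_ge0 => i _.
  by apply: (le_trans (H m)); rewrite lerD2l sum_geometric_half.
- move=> j; have [_ _ _ _ [M sE h]] := stP j.
  exists (s j), M.+1; split; first exact: sge.
  apply: eq_block_good h => i si; rewrite -sE in si.
  by have [-> _ _] := agi j.+1 i si.
Qed.

End Stages.

(** * Limits and the operator *)

Section Limits.
Variables (R : realType) (K : numFieldType) (S : real_part R K).
Local Notation inc := (inc S).
Local Notation re := (re S).

Section Topology.
Variable X : normedModType K.
Local Notation nrm := (@nrm R K S X).

Lemma nbhs_nrm (x : X) (A : set X) :
  nbhs x A <-> exists2 r, 0 < r & forall y, nrm (y - x) < r -> A y.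
Proof.
split=> [/nbhs_ballP[e e0 eA]|[r r0 rA]].
  exists (re e); first by rewrite -(ltr_inc S) rmorph0 reK// ltW.
  move=> y yx; apply: eA; rewrite -ball_normE/= distrC -(reK S (ltW e0)).
  by rewrite -(reK S (normr_ge0 _)) (ltr_inc S).
apply/nbhs_ballP; exists (inc r); first by rewrite /= inc_gt0.
move=> y; rewrite -ball_normE/= distrC => yx; apply: rA.
by rewrite -(ltr_inc S) reK.
Qed.

Lemma open_nrm (A : set X) :
  open A <-> forall x, A x -> exists2 r, 0 < r & forall y, nrm (y - x) < r -> A y.
Proof.
rewrite openE; split=> [h x /h/nbhs_nrm//|h x /h hx]; exact/nbhs_nrm.
Qed.

Lemma dense_nrm (A : set X) :
  dense A <-> forall x r, 0 < r -> exists2 y, A y & nrm (y - x) < r.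
Proof.
split=> [dA x r r0|h O [x Ox] /open_nrm oO].
  have [||y [/= yx Ay]] := dA [set y | nrm (y - x) < r]; last by exists y.
  - by exists x => /=; rewrite subrr nrm0.
  - apply/open_nrm => y /= yx; exists (r - nrm (y - x)); first by rewrite subr_gt0.
    move=> z zy; rewrite -(subrK y z) -addrA.
    by apply: (le_lt_trans (nrmD _ _ _)); rewrite -ltrBrDr.
have [r r0 rO] := oO x Ox; have [y Ay yx] := h x r r0.
by exists y; split=> //; exact: rO.
Qed.

Lemma nrm_limit_unique (u : nat -> X) l l' :
  (forall e, 0 < e -> exists n0, forall n, (n0 <= n)%N -> nrm (u n - l) <= e) ->
  (forall e, 0 < e -> exists n0, forall n, (n0 <= n)%N -> nrm (u n - l') <= e) -> l = l'.
Proof.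
move=> h h'; apply/eqP; rewrite -subr_eq0; apply: contraT; rewrite -(nrm_gt0 S) => d0.
have d3 : 0 < nrm (l - l') / 3 by rewrite divr_gt0.
have [n0 H] := h _ d3; have [n1 H'] := h' _ d3.
have := H _ (leq_maxl n0 n1); have := H' _ (leq_maxr n0 n1); set u' := u _.
have := nrmD S (l - u') (u' - l'); rewrite addrA subrK (nrmB S l u').
lra.
Qed.

End Topology.

Section Complete.
Variable X : completeNormedModType K.
Local Notation nrm := (@nrm R K S X).

Lemma nrm_complete (u : nat -> X) (a : nat -> R) A :
  (forall n, nrm (u n.+1 - u n) <= a n) -> (forall m, \sum_(0 <= n < m) a n <= A) ->
  exists l, forall e, 0 < e -> exists n0, forall n, (n0 <= n)%N -> nrm (u n - l) <= e.
Proof.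
move=> ua aA; have a0 n : 0 <= a n by rewrite (le_trans _ (ua n))// nrm_ge0.
pose s m := \sum_(0 <= n < m) a n.
have us m n : (m <= n)%N -> nrm (u n - u m) <= s n - s m.
  elim: n => [|n IH]; first by rewrite leqn0 => /eqP ->; rewrite !subrr nrm0.
  rewrite leq_eqVlt => /orP[/eqP ->|mn]; first by rewrite !subrr nrm0.
  rewrite -(subrK (u n) (u n.+1)) -addrA; apply: (le_trans (nrmD _ _ _)).
  rewrite /s big_nat_recr//= -/(s n) addrAC [leRHS]addrC; apply: lerD => //; exact: IH.
have hs : has_sup (range s).
  split; first by exists (s 0%N), 0%N.
  by exists A => _ [m _ <-]; exact: aA.
have ls n : s n <= sup (range s) by apply: ub_le_sup; [case: hs|exists n].
have : cvg (u @ \oo).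
  apply: cauchy_cvg; apply: cauchy_exP => e e0.
  have re0 : 0 < re e by rewrite -(ltr_inc S) rmorph0 reK// ltW.
  have [_ [n _ <-] hn] := sup_adherent re0 hs.
  exists (u n); exists n => // m /= nm.
  rewrite -ball_normE/= distrC -(reK S (ltW e0)) -(reK S (normr_ge0 _)) (ltr_inc S).
  by apply: (le_lt_trans (us _ _ nm)); have := ls m; lra.
move=> /cvg_ex[l ul]; exists l => e e0.
have /ul : nbhs l [set y | nrm (y - l) < e] by apply/nbhs_nrm; exists e.
by move=> [n0 _ h]; exists n0 => n /h /= /ltW.
Qed.

Lemma baire_nrm (F : nat -> set X) : (forall i, open (F i)) -> (forall i, dense (F i)) ->
  dense (\bigcap_i F i).
Proof.
move=> oF dF; apply/(dense_nrm (\bigcap_i F i)) => x r r0.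
pose T := (X * {posnum R})%type.
(* Distance of centres plus new radius at most the old radius: closed balls are nested. Halving the
   radii makes them summable. *)
have step (p : nat * T) : exists q : T,
    (forall y, nrm (y - q.1) <= q.2%:num -> F p.1 y) /\
    nrm (q.1 - p.2.1) + q.2%:num <= p.2.2%:num /\ q.2%:num <= p.2.2%:num / 2.
  case: p => n [z d] /=; have d2 : 0 < d%:num / 2 by rewrite divr_gt0.
  have [y Fy yz] := (dense_nrm (F n)).1 (dF n) z _ d2.
  have [e e0 eF] := (open_nrm (F n)).1 (oF n) y Fy.
  have m0 : 0 < Order.min (e / 2) (d%:num / 2) by rewrite lt_min d2 divr_gt0.
  exists (y, PosNum m0) => /=; split.
    move=> w /le_lt_trans wy; apply: eF; apply: wy; rewrite gt_min; apply/orP; left; lra.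
  have m2 : Order.min (e / 2) (d%:num / 2) <= d%:num / 2 by rewrite ge_min lexx orbT.
  split=> //; lra.
have [nxt nxtP] := choice step.
have r2 : 0 < r / 2 by rewrite divr_gt0.
pose st := fix st n : T := if n is m.+1 then nxt (m, st m) else (x, PosNum r2).
pose u n := (st n).1; pose d n := (st n).2%:num.
have uP n : (forall y, nrm (y - u n.+1) <= d n.+1 -> F n y) /\
    nrm (u n.+1 - u n) + d n.+1 <= d n /\ d n.+1 <= d n / 2 := nxtP (n, st n).
have d0 n : 0 < d n by exact: [gt0 of (st n).2%:num].
have dsum m : \sum_(0 <= n < m) d n <= r.
  suff : \sum_(0 <= n < m) d n <= r - 2 * d m by move=> h; have := d0 m; lra.
  elim: m => [|m IH]; first by rewrite big_geq// /d/=; lra.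
  by rewrite big_nat_recr//=; have [_ [_ h]] := uP m; lra.
have ud n : nrm (u n.+1 - u n) <= d n by have [_ [h _]] := uP n; have := d0 n.+1; lra.
have [l lP] := nrm_complete ud dsum.
have un m n : (n <= m)%N -> nrm (u m - u n) + d m <= d n.
  elim: m => [|m IH]; first by rewrite leqn0 => /eqP ->; rewrite subrr nrm0 add0r.
  rewrite leq_eqVlt => /orP[/eqP ->|nm]; first by rewrite subrr nrm0 add0r.
  have := nrmD S (u m.+1 - u m) (u m - u n); rewrite addrA subrK.
  by have := IH nm; have [_ [h _]] := uP m; lra.
have ln n : nrm (l - u n) <= d n.
  rewrite leNgt; apply/negP => h.
  have e0 : 0 < (nrm (l - u n) - d n) / 2 by rewrite divr_gt0// subr_gt0.
  have [n0 H] := lP _ e0; have := H _ (leq_maxl n0 n); have := un _ _ (leq_maxr n0 n).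
  set m := maxn _ _; have := nrmD S (l - u m) (u m - u n); rewrite addrA subrK (nrmB S l (u m)).
  by have := d0 m; lra.
exists l; last by apply: le_lt_trans (ln 0%N) _; rewrite /d/=; lra.
by move=> n _; have [h _] := uP n; apply: h; exact: ln.
Qed.

Lemma taylor_operator (B : bsys R X) A : (forall s, biorth S s B) ->
  (forall m, \sum_(0 <= n < m) bC B n * nrm (taylor_vec S (bv B) n) <= A) ->
  exists T : bounded_operator X, forall n, T (bv B n) = bv B n + taylor_vec S (bv B) n.
Proof.
move=> bi hA; pose v := taylor_vec S (bv B).
have fS n : scalar (bf B n) by have [h _] := bi n.+1; have [] := h n (ltnSn n).
have fC n x : re `|bf B n x| <= bC B n * nrm x.
  by have [h _] := bi n.+1; have [_] := h n (ltnSn n); apply.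
have fb i j : bf B i (bv B j) = (i == j)%:R.
  by have [_ h] := bi (maxn i j).+1; apply: h; rewrite ltnS ?leq_maxl ?leq_maxr.
pose u x m := \sum_(0 <= n < m) bf B n x *: v n.
pose lim_to (u : nat -> X) l :=
  forall e, 0 < e -> exists n0, forall n, (n0 <= n)%N -> nrm (u n - l) <= e.
have ex x : exists l, lim_to (u x) l.
  apply: (@nrm_complete _ (fun n => bC B n * nrm (v n) * nrm x) (A * nrm x)) => [n|m].
    rewrite /u big_nat_recr//= addrAC subrr add0r nrmZ mulrAC.
    by rewrite ler_wpM2r ?nrm_ge0.
  by rewrite -mulr_suml ler_wpM2r ?nrm_ge0.
have [L LP] := choice ex.
have uB x n : nrm (u x n) <= A * nrm x.
  apply: (@le_trans _ _ (\sum_(0 <= k < n) bC B k * nrm (v k) * nrm x)); last first.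
    by rewrite -mulr_suml ler_wpM2r ?nrm_ge0.
  rewrite /u; elim: n => [|n IH]; first by rewrite !big_geq// nrm0.
  rewrite !big_nat_recr//=; apply: (le_trans (nrmD _ _ _)); apply: lerD => //.
  by rewrite nrmZ mulrAC ler_wpM2r ?nrm_ge0.
have LB x : nrm (L x) <= A * nrm x.
  rewrite leNgt; apply/negP => h.
  have e0 : 0 < (nrm (L x) - A * nrm x) / 2 by rewrite divr_gt0// subr_gt0.
  have [n0 H] := LP x _ e0; have := H _ (leqnn n0); have := uB x n0.
  have := nrmD S (L x - u x n0) (u x n0); rewrite subrK (nrmB S (L x)); lra.
have LS a x y : L (a *: x + y) = a *: L x + L y.
  apply: (nrm_limit_unique (LP (a *: x + y))) => e e0.
  have p0 : 0 < re `|a| + 1 by have := re_ge0 S (normr_ge0 a); lra.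
  have e1 : 0 < e / 2 / (re `|a| + 1) by rewrite !divr_gt0.
  have e2 : 0 < e / 2 by rewrite divr_gt0.
  have [n1 H1] := LP x _ e1; have [n2 H2] := LP y _ e2.
  exists (maxn n1 n2) => n; rewrite geq_max => /andP[h1 h2].
  have -> : u (a *: x + y) n = a *: u x n + u y n.
    rewrite /u scaler_sumr -big_split/=; apply: eq_bigr => k _.
    by rewrite fS scalerDl scalerA.
  rewrite opprD addrACA -scalerBr; apply: (le_trans (nrmD _ _ _)); rewrite nrmZ.
  rewrite [leRHS](splitr e); apply: lerD; last exact: H2.
  apply: (@le_trans _ _ ((re `|a| + 1) * nrm (u x n - L x))).
    by rewrite ler_wpM2r ?nrm_ge0// lerDl.
  by rewrite -ler_pdivlMl// mulrC; exact: H1.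
pose f x := x + L x.
have fL : linear f by move=> a x y; rewrite /f LS scalerDr addrACA.
pose g : {linear X -> X} := HB.pack f (GRing.isLinear.Build K X X *:%R f fL).
have gB : exists M : K, forall x, `|g x| <= M * `|x|.
  exists (inc (1 + A)) => x; rewrite -(reK S (normr_ge0 (g x))) -(reK S (normr_ge0 x)).
  rewrite -rmorphM (ler_inc S) /= mulrDl mul1r.
  apply: (le_trans (re_normD _ _ _)); apply: lerD => //; exact: LB.
exists (BoundedOperator gB) => n; rewrite /= /f; congr (_ + _).
apply: (nrm_limit_unique (LP (bv B n))) => e e0; exists n.+1 => m nm.
suff -> : u (bv B n) m = v n by rewrite subrr nrm0 ltW.
rewrite /u big_mkord (bigD1 (Ordinal nm))//= fb eqxx scale1r big1 ?addr0// => k kn.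
rewrite fb [(k : nat) == n](_ : _ = false) ?scale0r//.
by apply: contraNF kn => /eqP ij; apply/eqP/val_inj.
Qed.

End Complete.
End Limits.

(** * Extended lower and upper limits *)

Section ExtendedLimits.
Variable R : realType.

Lemma limn_einf_eq0 (u : nat -> R) : (forall n, 0 <= u n) ->
  (forall (k : nat), exists2 n, (k < n)%N & u n < k.+1%:R^-1) ->
  limn_einf (EFin \o u) = 0%E.
Proof.
move=> u0 uk; rewrite limn_einf_lim; apply/cvg_lim => //.
suff -> : einfs (EFin \o u) = fun=> 0%E by exact: cvg_cst.
apply/funext => n; rewrite /einfs /=; apply/eqP; rewrite eq_le; apply/andP; split; last first.
  by apply: le_ereal_inf_tmp => _ [m _ <-]; rewrite lee_fin.
apply/lee_addgt0Pr => e e0; rewrite add0e.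
pose k := maxn n (Num.truncn e^-1); have [m km um] := uk k.
apply: (@le_trans _ _ (u m)%:E).
  by apply: ereal_inf_lbound; exists m => //=; rewrite (leq_trans (leq_maxl _ _) (ltnW km)).
rewrite lee_fin ltW// (lt_le_trans um)// -[leRHS]invrK lef_pV2 ?posrE ?invr_gt0//.
by rewrite ltW// (lt_le_trans (truncnS_gt _))// ler_nat ltnS leq_maxr.
Qed.

Lemma limn_esup_eqy (u : nat -> R) :
  (forall (k : nat), exists2 n, (k < n)%N & k%:R < u n) ->
  limn_esup (EFin \o u) = +oo%E.
Proof.
move=> uk; rewrite limn_esup_lim; apply/cvg_lim => //.
suff -> : esups (EFin \o u) = fun=> +oo%E by exact: cvg_cst.
apply/funext => n; rewrite /esups /=; apply/eqyP => A A0.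
pose k := maxn n (Num.truncn A).+1; have [m km um] := uk k.
apply: (@le_trans _ _ (u m)%:E).
  rewrite lee_fin ltW// (lt_trans _ um)// (lt_le_trans (truncnS_gt _))//.
  by rewrite ler_nat leq_maxr.
by apply: ereal_sup_ubound; exists m => //=; rewrite (leq_trans (leq_maxl _ _) (ltnW km)).
Qed.

End ExtendedLimits.

(** * Dynamics *)

(** Taylor's formula, summed over all k < s so that it matches the matrix of T in [operator_basis],
    whose entries are 1/(k - j)!. *)
Lemma horner_derivn_shift (R : realType) (f : {poly R}) s j x : (size f <= s)%N -> (j < s)%N ->
  f^`(j).[x + 1] = \sum_(k < s) if (j <= k)%N then f^`(k).[x] / (k - j)`!%:R else 0.
Proof.
move=> fs js; rewrite nderiv_taylor; last exact: mulrC.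
have szj : (size f^`(j) <= s - j)%N.
  apply/leq_sizeP => i; rewrite leq_subLR => ji; rewrite coef_derivn.
  by have /leq_sizeP -> // : (size f <= j + i)%N; rewrite ?mul0rn//; exact: leq_trans ji.
rewrite -(big_mkord xpredT (fun i => (f^`(j))^`N(i).[x] * 1 ^+ i)).
rewrite -(big_mkord xpredT (fun k => if (j <= k)%N then f^`(k).[x] / (k - j)`!%:R else 0)).
rewrite [RHS](big_cat_nat _ (ltnW js))//= [X in _ = X + _]big_nat_cond [X in _ = X + _]big1
  ?add0r; last first.
  by move=> i /andP[/andP[_ ij] _]; rewrite leqNgt ij.
rewrite -[X in _ = \sum_(X <= _ < s) _]add0n big_addn.
rewrite [RHS](big_cat_nat _ szj)//= [X in _ = _ + X]big_nat_cond [X in _ = _ + X]big1 ?addr0;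
  last first.
  move=> i /andP[/andP[ij _] _]; rewrite leq_addl addnK [(i + j)%N]addnC -[f^`(j + i)](_ :
    (f^`(j))^`(i) = _); last first.
    by rewrite /derivn -iterD addnC.
  by rewrite derivn_poly0 ?horner0 ?mul0r.
apply: eq_bigr => i _; rewrite leq_addl addnK expr1n mulr1.
have -> : f^`(i + j) = (f^`(j))^`N(i) *+ i`! by rewrite -nderivn_def /derivn -iterD.
by rewrite hornerMn -mulr_natr mulfK// gt_eqF ?fact_gt0R.
Qed.

Lemma derivn_reflect (R : realType) (f : {poly R}) (N : R) k t :
  (f \Po (N%:P - 'X))^`(k).[t] = (-1) ^+ k * f^`(k).[N - t].
Proof.
have -> : N%:P - 'X = N%:P + (-1) *: 'X :> {poly R} by rewrite scaleN1r.
by rewrite derivn_comp_affine hornerZ horner_comp hornerD hornerC hornerZ hornerX mulN1r.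
Qed.

Section Dynamics.
Variables (R : realType) (K : numFieldType) (S : real_part R K).
Variable X : completeNormedModType K.
Local Notation inc := (inc S).
Local Notation re := (re S).
Local Notation nrm := (@nrm R K S X).
Variable T : bounded_operator X.

Lemma iter_linear i : linear (fun x => iter i T x).
Proof. by elim: i => // i IH a x y; rewrite /= IH linearP. Qed.

Lemma iterD i x y : iter i T (x + y) = iter i T x + iter i T y.
Proof. by have := iter_linear i 1 x y; rewrite !scale1r. Qed.

Lemma iter0 i : iter i T 0 = 0.
Proof. by elim: i => //= i ->; rewrite linear0. Qed.

Lemma iterZ i a x : iter i T (a *: x) = a *: iter i T x.
Proof. by have := iter_linear i a x 0; rewrite !addr0 iter0 addr0. Qed.

Lemma iterB i x y : iter i T (x - y) = iter i T x - iter i T y.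
Proof. by rewrite iterD -scaleN1r iterZ scaleN1r. Qed.

Lemma iter_sum i s (c : nat -> K) (x : nat -> X) :
  iter i T (\sum_(k < s) c k *: x k) = \sum_(k < s) c k *: iter i T (x k).
Proof.
elim: s => [|s IH]; first by rewrite !big_ord0 iter0.
by rewrite !big_ord_recr/= iterD IH iterZ.
Qed.

Lemma operator_nrm : exists2 L, 1 <= L & forall i x, nrm (iter i T x) <= L ^+ i * nrm x.
Proof.
have [M MP] := operator_bounded T.
have H x : nrm (T x) <= (re `|M| + 1) * nrm x.
  apply: (@le_trans _ _ (re `|M| * nrm x)); last first.
    by rewrite ler_wpM2r ?nrm_ge0// lerDl.
  rewrite -nrmZ re_le//; apply: (le_trans (MP x)); rewrite normrZ.
  have : 0 <= M * `|x| by apply: le_trans (MP x).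
  by move=> /ger0_norm; rewrite normrM normr_id => ->.
have r0 : 0 <= re `|M| by exact: re_ge0.
exists (re `|M| + 1); first by lra.
elim=> [|i IH] x; first by rewrite expr0 mul1r.
apply: (le_trans (H _)); rewrite exprS -mulrA; apply: ler_wpM2l; [lra|exact: IH].
Qed.

(** Convertible to [orbit_mean], with the norm read through [nrm]. *)
Definition omean x n : R := n%:R^-1 * \sum_(1 <= i < n.+1) nrm (iter i T x).

Lemma omean_ge0 x n : 0 <= omean x n.
Proof. by rewrite mulr_ge0 ?invr_ge0// sumr_ge0// => i _; exact: nrm_ge0. Qed.

Lemma omeanD x y n : omean (x + y) n <= omean x n + omean y n.
Proof.
rewrite -mulrDr ler_wpM2l ?invr_ge0// -big_split/=; apply: ler_sum => i _.
by rewrite iterD nrmD.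
Qed.

Lemma omeanZ a x n : omean (a *: x) n = re `|a| * omean x n.
Proof.
rewrite /omean mulrCA; congr (_ * _); rewrite mulr_sumr; apply: eq_bigr => i _.
by rewrite iterZ nrmZ.
Qed.

Lemma omean_le n : exists2 L, 0 < L & forall x, omean x n <= L * nrm x.
Proof.
have [L L1 LP] := operator_nrm.
exists (n%:R^-1 * \sum_(1 <= i < n.+1) L ^+ i + 1).
  rewrite ltr_wpDl// mulr_ge0 ?invr_ge0// sumr_ge0// => i _; rewrite exprn_ge0//; lra.
move=> x; apply: (@le_trans _ _ (n%:R^-1 * \sum_(1 <= i < n.+1) L ^+ i * nrm x)).
  by rewrite ler_wpM2l ?invr_ge0//; apply: ler_sum => i _.
by rewrite -mulr_suml mulrA ler_wpM2r ?nrm_ge0// lerDl.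
Qed.

Lemma open_omean_lt n a : open [set x | omean x n < a].
Proof.
have [L L0 LP] := omean_le n.
apply/(open_nrm S) => x /= xa; exists ((a - omean x n) / L); first by rewrite divr_gt0// subr_gt0.
move=> y; rewrite ltr_pdivlMr// => yx.
rewrite -(subrK x y); apply: (le_lt_trans (omeanD _ _ _)).
by rewrite -ltrBrDr; apply: le_lt_trans (LP _) _; rewrite mulrC.
Qed.

Lemma open_omean_gt n a : open [set x | a < omean x n].
Proof.
have [L L0 LP] := omean_le n.
apply/(open_nrm S) => x /= xa; exists ((omean x n - a) / L); first by rewrite divr_gt0// subr_gt0.
move=> y; rewrite ltr_pdivlMr// nrmB mulrC => yx.
have := omeanD (x - y) y n; rewrite subrK; have := LP (x - y); lra.
Qed.

Lemma open_iter_near n y r : open [set x | nrm (iter n T x - y) < r].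
Proof.
have [L L1 LP] := operator_nrm; have Ln : 0 < L ^+ n by rewrite exprn_gt0//; lra.
apply/(open_nrm S) => x /= xa; exists ((r - nrm (iter n T x - y)) / L ^+ n).
  by rewrite divr_gt0// subr_gt0.
move=> z; rewrite ltr_pdivlMr// mulrC => zx.
rewrite -(subrK (iter n T x) (iter n T z)) -addrA; apply: (le_lt_trans (nrmD _ _ _)).
by rewrite -ltrBrDr -iterB; apply: le_lt_trans (LP _ _) _.
Qed.

(** * The operator as translation of jets *)

Section Basis.
Variable B : bsys R X.
Local Notation b := (bv B).
Hypothesis bi : forall s, biorth S s B.
Hypothesis Tb : forall n, T (b n) = b n + taylor_vec S b n.
Hypothesis good : forall j, exists s M, (j <= s)%N /\
      block_good s M j (fun k => nrm (b k)) ((1 / 2) ^+ j).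

(* The vector representing t |-> f (x + t), as [b k] stands for t^k/k!. *)
Definition jet s (f : {poly R}) x := \sum_(k < s) inc f^`(k).[x] *: b k.

Lemma nrm_jet s f x : nrm (jet s f x) <= wnorm (fun k => nrm (b k)) s f x.
Proof.
apply: (le_trans (nrm_sum _ _)); apply: ler_sum => k _.
by rewrite nrm_incZ mulrC.
Qed.

Lemma operator_basis s k : (k < s)%N ->
  T (b k) = \sum_(j < s) (if (j <= k)%N then inc (k - j)`!%:R^-1 else 0) *: b j.
Proof.
move=> ks; rewrite Tb /taylor_vec (big_ord_widen s (fun j => inc (k - j)`!%:R^-1 *: b j) (ltnW ks)).
rewrite big_mkcond/= [RHS](bigD1 (Ordinal ks))//= leqnn subnn fact0 invr1 rmorph1 scale1r;
  congr (_ + _).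
rewrite [LHS](bigD1 (Ordinal ks))//= ltnn add0r; apply: eq_bigr => j jk.
rewrite [(j <= k)%N]leq_eqVlt [(j : nat) == k](_ : _ = false); last first.
  by apply: contraNF jk => /eqP ij; apply/eqP/val_inj.
by case: ifP => //= _; rewrite scale0r.
Qed.

Lemma operator_jet s (f : {poly R}) x : (size f <= s)%N -> T (jet s f x) = jet s f (x + 1).
Proof.
move=> fs; rewrite /jet; have /= := iter_sum 1 s (fun k => inc f^`(k).[x]) b => ->.
under eq_bigr => k _ do rewrite (operator_basis (ltn_ord k)) scaler_sumr.
rewrite exchange_big/=; apply: eq_bigr => j _.
rewrite (horner_derivn_shift _ fs (ltn_ord j)) rmorph_sum/= scaler_suml; apply: eq_bigr => k _.
by rewrite scalerA; case: ifP => _; rewrite ?mulr0 ?rmorph0// rmorphM.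
Qed.

Lemma iter_jet s (f : {poly R}) x i : (size f <= s)%N -> iter i T (jet s f x) = jet s f (x + i%:R).
Proof.
move=> fs; elim: i => [|i IH]; first by rewrite addr0.
by rewrite /= IH operator_jet// -addrA natr1.
Qed.

Lemma jet_monomial s m : (m < s)%N -> jet s (m`!%:R^-1 *: 'X^m) 0 = b m.
Proof.
move=> ms; rewrite /jet (bigD1 (Ordinal ms))//= big1 ?addr0 => [|k km].
  rewrite derivn_horner0 coefZ coefXn eqxx mulr1 -[_^-1 *+ _]mulr_natr mulVf ?rmorph1 ?scale1r//.
rewrite derivn_horner0 coefZ coefXn [(k : nat) == m](_ : _ = false).
  by rewrite mulr0 mul0rn rmorph0 scale0r.
by apply: contraNF km => /eqP ij; apply/eqP/val_inj.
Qed.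

Lemma jetB s (f g : {poly R}) x : jet s (f - g) x = jet s f x - jet s g x.
Proof.
rewrite /jet -sumrB; apply: eq_bigr => k _.
by rewrite derivnB hornerD hornerN rmorphB scalerBl.
Qed.

Lemma wnorm_reflect (g : nat -> R) s (f : {poly R}) (N t : R) :
  wnorm g s (f \Po (N%:P - 'X)) t = wnorm g s f (N - t).
Proof.
apply: eq_bigr => k _; rewrite derivn_reflect normrM normrX normrN normr1 expr1n mul1r//.
Qed.

(* [x] is the jet at 0 of the polynomial f given by [good], and [y] that of its
   reflection t |-> f (N - t), up to sign. *)
Lemma basis_approx j : exists s N, [/\ (j <= s)%N, (j < N)%N & forall m, (m < s)%N ->
  exists x y, [/\ nrm (x - b m) <= (1 / 2) ^+ j, omean x N <= (1 / 2) ^+ j,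
    nrm (iter N T x) <= (1 / 2) ^+ j, nrm y <= (1 / 2) ^+ j &
    nrm (iter N T y - b m) <= (1 / 2) ^+ j]].
Proof.
have [s [M [js [N jN H]]]] := good j.
exists s, N; split=> // m ms; have [f [fs f1 f2 f3]] := H m ms.
have msM : (m < s + M)%N by apply: leq_trans ms (leq_addr _ _).
pose f' := f \Po (N%:R%:P - 'X).
have f's : (size f' <= s + M)%N.
  apply: (leq_trans (size_comp_poly_leq _ _)).
  have -> : size (N%:R%:P - 'X : {poly R}) = 2%N by rewrite -opprB size_polyN size_XsubC.
  by rewrite muln1; case: (size f) fs => [_|n ->] //=; apply: leq_ltn_trans msM.
exists (jet (s + M) f 0), ((-1) ^+ m *: jet (s + M) f' 0); split.
- by rewrite -(jet_monomial msM) -jetB (le_trans (nrm_jet _ _ _)).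
- rewrite /omean ler_pdivrMl ?ltr0n ?(leq_ltn_trans _ jN)// [leRHS]mulrC.
  apply: le_trans f2; apply: ler_sum => i _.
  by rewrite iter_jet// add0r nrm_jet.
- by rewrite iter_jet// add0r (le_trans (nrm_jet _ _ _)).
- rewrite nrmZ normrX normrN1 expr1n re1 mul1r (le_trans (nrm_jet _ _ _))//.
  by rewrite wnorm_reflect subr0.
- rewrite iterZ iter_jet// add0r -(jet_monomial msM).
  pose g := (m`!%:R^-1 *: 'X^m) : {poly R}; pose g' := g \Po (N%:R%:P - 'X).
  (* At t = N only the m-th derivative of (N - t)^m/m! survives, and it equals (-1)^m. *)
  have -> : jet (s + M) g 0 = (-1) ^+ m *: jet (s + M) g' N%:R.
    rewrite /jet scaler_sumr; apply: eq_bigr => k _.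
    rewrite scalerA derivn_reflect subrr derivn_horner0 coefZ coefXn.
    have [->|km] := eqVneq (k : nat) m; last by rewrite mulr0 mul0rn mulr0 rmorph0 mulr0.
    by rewrite [in RHS]rmorphM rmorphXn rmorphN1 mulrA -exprMn mulN1r opprK expr1n mul1r.
  rewrite -scalerBr -jetB nrmZ normrX normrN1 expr1n re1 mul1r (le_trans (nrm_jet _ _ _))//.
  by rewrite /g' /f' -comp_polyB wnorm_reflect subrr.
Qed.

Lemma span_approx s z w e j0 : in_span s b z -> in_span s b w -> 0 < e ->
  exists N x y, [/\ (j0 < N)%N & [/\ nrm (x - z) <= e, omean x N <= e,
    nrm (iter N T x) <= e, nrm y <= e & nrm (iter N T y - w) <= e]].
Proof.
move=> [c zE] [d wE] e0.
pose A := \sum_(k < s) re `|c k| + \sum_(k < s) re `|d k|.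
have c0 : 0 <= \sum_(k < s) re `|c k| by apply: sumr_ge0 => k _; exact: re_ge0.
have d0 : 0 <= \sum_(k < s) re `|d k| by apply: sumr_ge0 => k _; exact: re_ge0.
have [Q0 HQ] := exp2_beats_power (A / e) 0.
(* j >= s lets [basis_approx] reach all indices below s, and j >= Q0 makes (1/2)^j small against the
   coefficients. *)
pose j := (maxn (maxn j0 s) Q0).
have jA : A * (1 / 2) ^+ j <= e.
  have := HQ j (leq_maxr _ _); rewrite expr0 mulr1 ler_pdivrMr// => h.
  by rewrite mul1r exprVn ler_pdivrMr ?exprn_gt0// mulrC.
have h0 : 0 <= (1 / 2) ^+ j :> R by rewrite exprn_ge0//; lra.
have [s' [N [js jN H]]] := basis_approx j.
have ss' k : (k < s)%N -> (k < s')%N.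
  move=> ks; apply: leq_trans js; apply: leq_trans ks _.
  exact: leq_trans (leq_maxr _ _) (leq_maxl _ _).
have [x0 xP] := @choice nat X (fun k x => (k < s)%N -> [/\ nrm (x - b k) <= (1 / 2) ^+ j, omean x
  N <= (1 / 2) ^+ j & nrm (iter N T x) <= (1 / 2) ^+ j]) ltac:(
  move=> k; have [ks|_] := ltnP k s; last (by exists 0);
    by have [x [y [? ? ? _ _]]] := H k (ss' k ks); exists x).
have [y0 yP] := @choice nat X (fun k y => (k < s)%N -> nrm y <= (1 / 2) ^+ j /\ nrm (iter N T y -
  b k) <= (1 / 2) ^+ j) ltac:(
  move=> k; have [ks|_] := ltnP k s; last (by exists 0);
    by have [x [y [_ _ _ ? ?]]] := H k (ss' k ks); exists y).
have bound (a : nat -> K) (F : 'I_s -> X) : \sum_(k < s) re `|a k| <= A ->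
   (forall k, nrm (F k) <= (1 / 2) ^+ j) -> nrm (\sum_(k < s) a k *: F k) <= e.
  move=> aA FP; apply: (le_trans (nrm_sum _ _)).
  apply: (@le_trans _ _ (\sum_(k < s) re `|a k| * (1 / 2) ^+ j)).
    by apply: ler_sum => k _; rewrite nrmZ ler_wpM2l ?re_ge0.
  by rewrite -mulr_suml; apply: le_trans jA; rewrite ler_wpM2r.
have cA : \sum_(k < s) re `|c k| <= A by rewrite lerDl.
have dA : \sum_(k < s) re `|d k| <= A by rewrite lerDr.
exists N, (\sum_(k < s) c k *: x0 k), (\sum_(k < s) d k *: y0 k); split.
  by apply: leq_ltn_trans jN; exact: leq_trans (leq_maxl _ _) (leq_maxl _ _).
split.
- rewrite zE -sumrB; under eq_bigr do rewrite -scalerBr.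
  by apply: bound => // k; have [] := xP k (ltn_ord k).
- apply: (@le_trans _ _ (\sum_(k < s) re `|c k| * (1 / 2) ^+ j)); last first.
    by rewrite -mulr_suml; apply: le_trans jA; rewrite ler_wpM2r.
  elim/big_ind2: _ => [|x a y a' xa ya|k _].
  + by have := omeanZ 0 0 N; rewrite scaler0 normr0 re0 mul0r => ->.
  + exact: le_trans (omeanD _ _ _) (lerD xa ya).
  + by rewrite omeanZ ler_wpM2l ?re_ge0//; have [] := xP k (ltn_ord k).
- rewrite iter_sum; apply: (bound c (fun k => iter N T (x0 k))) => // k.
  by have [] := xP k (ltn_ord k).
- by apply: bound => // k; have [] := yP k (ltn_ord k).
- rewrite iter_sum wE -sumrB; under eq_bigr do rewrite -scalerBr.
  by apply: (bound d (fun k => iter N T (y0 k) - b k)) => // k; have [] := yP k (ltn_ord k).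
Qed.

Lemma iter_basis1 i : iter i T (b 1) = b 1 + inc i%:R *: b 0.
Proof.
have T0 : T (b 0) = b 0 by rewrite Tb /taylor_vec big_ord0 addr0.
elim: i => [|i IH]; first by rewrite rmorph0 scale0r addr0.
rewrite /= IH linearD linearZ/= T0 Tb /taylor_vec big_ord_recr big_ord0/= add0r.
by rewrite subn0 invr1 -addrA -scalerDl -rmorphD nat1r.
Qed.

Lemma omean_basis1 n : (0 < n)%N -> n.+1%:R / 2 * nrm (b 0) - nrm (b 1) <= omean (b 1) n.
Proof.
move=> n0; rewrite /omean ler_pdivlMl ?ltr0n//.
apply: (@le_trans _ _ (\sum_(1 <= i < n.+1) (i%:R * nrm (b 0) - nrm (b 1)))).
  rewrite sumrB -mulr_suml sumr_const_nat subn1/= -[_ *+ n]mulr_natr.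
  have -> : \sum_(1 <= i < n.+1) i%:R = n%:R * n.+1%:R / 2 :> R.
    elim: n {n0} => [|n IH]; first by rewrite big_geq// !mul0r.
    by rewrite big_nat_recr//= IH -!natr1; field.
  by rewrite le_eqVlt; apply/orP; left; apply/eqP; ring.
apply: ler_sum => i _; rewrite iter_basis1.
have := nrmD S (b 1 + inc i%:R *: b 0) (- b 1).
by rewrite addrAC subrr add0r nrm_incZ normr_nat nrmN; lra.
Qed.

(** * Baire category arguments *)

Section Residual.
Variable d : nat -> X.
Hypothesis d_span : forall j, exists s, in_span s b (d j).
Hypothesis d_dense : forall x r, 0 < r -> exists j, nrm (d j - x) < r.

Lemma dense_small_mean k :
  dense [set x | exists2 n, (k < n)%N & omean x n < k.+1%:R^-1].
Proof.
apply/(dense_nrm S) => x r r0.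
have r2 : 0 < r / 2 by rewrite divr_gt0.
have [j dj] := d_dense x r2; have [s ds] := d_span j.
pose e := Order.min (r / 2) (k.+1%:R^-1 / 2).
have e0 : 0 < e by rewrite lt_min r2 divr_gt0// invr_gt0.
have [N [u [_ [kN [ud um _ _ _]]]]] := span_approx k ds ds e0.
exists u.
  exists N => //; apply: (le_lt_trans um); rewrite gt_min; apply/orP; right.
  have : 0 < k.+1%:R^-1 :> R by rewrite invr_gt0.
  by move=> h; rewrite ltr_pdivrMr// ltr_pMr// ltr1n.
have er : e <= r / 2 by rewrite ge_min lexx.
have := nrmD S (u - d j) (d j - x); rewrite addrA subrK; lra.
Qed.

(** For n large the mean of t b_1 exceeds 2 k, so by subadditivity the means of x and of x + t b_1
    cannot both be at most k. *)
Lemma dense_large_mean k : dense [set x | exists2 n, (k < n)%N & k%:R < omean x n].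
Proof.
apply/(dense_nrm S) => x r r0.
have b0 : 0 < nrm (b 0) by exact: (biorth_nrm_gt0 (bi 1)).
have b1 : 0 < nrm (b 1) by exact: (biorth_nrm_gt0 (bi 2)).
pose t := r / 2 / nrm (b 1); have t0 : 0 < t by rewrite !divr_gt0.
pose n := (maxn k (Num.truncn ((2 * k%:R / t + nrm (b 1)) * 2 / nrm (b 0))).+1).+1.
have kn : (k < n)%N by rewrite ltnS leq_maxl.
have nbig : 2 * k%:R < t * omean (b 1) n.
  rewrite [t * _]mulrC -ltr_pdivrMr//; apply: lt_le_trans (omean_basis1 (leq_ltn_trans (leq0n k)
    kn)).
  rewrite ltrBrDr [ltRHS]mulrAC ltr_pdivlMr// -ltr_pdivrMr//.
  by apply: (lt_trans (truncnS_gt _)); rewrite ltr_nat ltnS /n leqW// leq_maxr.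
have [xk|xk] := ltP k%:R (omean x n).
  exists x; last by rewrite subrr nrm0.
  by exists n.
exists (x + inc t *: b 1).
  exists n => //; have := omeanD (x + inc t *: b 1) (- 1 *: x) n.
  rewrite scaleN1r addrAC subrr add0r omeanZ re_norm_inc (gtr0_norm t0) -scaleN1r omeanZ normrN1
    re1 mul1r.
  lra.
rewrite addrAC subrr add0r nrm_incZ gtr0_norm// divfK ?gt_eqF//; lra.
Qed.

Lemma residual_mean_irregular :
  residual [set x | limn_einf (EFin \o omean x) = 0%E /\ limn_esup (EFin \o omean x) = +oo%E].
Proof.
(* The two countable families are merged into one sequence, since a [Gdelta] set is a single
   countable intersection. *)
pose F i := if odd i then [set x | exists2 n, (i./2 < n)%N & omean x n < i./2.+1%:R^-1]
   else [set x | exists2 n, (i./2 < n)%N & i./2%:R < omean x n].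
have Fe k : F k.*2 = [set x | exists2 n, (k < n)%N & k%:R < omean x n].
  by rewrite /F odd_double/= doubleK.
have Fo k : F k.*2.+1 = [set x | exists2 n, (k < n)%N & omean x n < k.+1%:R^-1].
  by rewrite /F /= odd_double/= uphalf_double.
have oF i : open (F i).
  rewrite /F; case: ifP => _; apply/(open_nrm S) => x [n kn xn].
    have [r r0 rP] := (open_nrm S _).1 (open_omean_lt n _) x xn.
    by exists r => // y yx; exists n => //; exact: rP.
  have [r r0 rP] := (open_nrm S _).1 (open_omean_gt n _) x xn.
  by exists r => // y yx; exists n => //; exact: rP.
exists (\bigcap_i F i); split; first by exists F.
  apply: (baire_nrm S) => // i; rewrite /F; case: ifP => _.
    exact: dense_small_mean.
  exact: dense_large_mean.
move=> x xF; split.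
  apply: limn_einf_eq0 => [n|k]; first exact: omean_ge0.
  by have := xF k.*2.+1 I; rewrite Fo.
by apply: limn_esup_eqy => k; have := xF k.*2 I; rewrite Fe.
Qed.

(** Add a vector near x that is nearly 0 at time N to a vector near 0 that is close to w at the same
    time N. *)
Lemma transitive x w r : 0 < r -> exists N u, nrm (u - x) < r /\ nrm (iter N T u - w) < r.
Proof.
move=> r0; have r4 : 0 < r / 4 by rewrite divr_gt0.
have [j dj] := d_dense x r4; have [s ds] := d_span j.
have [j' dj'] := d_dense w r4; have [s' ds'] := d_span j'.
have z1 := in_span_le (leq_maxl s s') ds; have z2 := in_span_le (leq_maxr s s') ds'.
have [N [u [y [_ [h1 _ h3 h4 h5]]]]] := span_approx 0 z1 z2 r4.
exists N, (u + y); split.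
  have -> : u + y - x = (u - d j) + (d j - x) + y by rewrite addrA subrK addrAC.
  by have := nrmD S (u - d j + (d j - x)) y; have := nrmD S (u - d j) (d j - x); lra.
rewrite iterD; have -> : iter N T u + iter N T y - w = iter N T u + ((iter N T y - d j') + (d j'
  - w)).
  by rewrite [_ - d j' + _]addrA subrK addrA.
have := nrmD S (iter N T u) (iter N T y - d j' + (d j' - w)).
have := nrmD S (iter N T y - d j') (d j' - w); lra.
Qed.

(** Birkhoff's argument: for each j and k, the vectors whose orbit enters the ball of radius 1/(k+1)
    around d_j form a dense open set. *)
Lemma hypercyclic_operator : hypercyclic T.
Proof.
pose F i : set X := if @unpickle (nat * nat)%type i is Some p
  then [set u | exists N, nrm (iter N T u - d p.1) < p.2.+1%:R^-1] else setT.
have dF : dense (\bigcap_i F i).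
  apply: (baire_nrm S) => i; rewrite /F; case: (unpickle i) => [[j k]|].
  - apply/(open_nrm S) => x [N xN].
    have [r r0 rP] := (open_nrm S _).1 (open_iter_near N (d j) _) x xN.
    by exists r => // y yx; exists N; exact: rP.
  - exact: openT.
  - apply/(dense_nrm S) => x r r0 /=.
    have m0 : 0 < Order.min r k.+1%:R^-1 by rewrite lt_min r0 invr_gt0/=.
    have [N [u []]] := transitive x (d j) m0.
    rewrite !lt_min => /andP[ux _] /andP[_ uN]; exists u => //; by exists N.
  - by apply/(dense_nrm S) => x r r0; exists x => //; rewrite subrr nrm0.
have [x xF _] := (dense_nrm S _).1 dF 0 1 ltr01.
exists x; apply/(dense_nrm S) => y r r0.
have r2 : 0 < r / 2 by rewrite divr_gt0.
have [j dj] := d_dense y r2.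
pose k := Num.truncn (r / 2)^-1.
have kr : k.+1%:R^-1 < r / 2.
  by rewrite -[ltRHS]invrK ltf_pV2 ?posrE ?invr_gt0// truncnS_gt.
have := xF (pickle (j, k)) I; rewrite /F pickleK => -[N /= xN].
exists (iter N T x); first by exists N.
have {kr} := lt_trans xN kr; have {xN} := nrmD S (iter N T x - d j) (d j - y).
rewrite addrA subrK; lra.
Qed.

End Residual.
End Basis.
End Dynamics.

(** * Density *)

Section Density.
Variables (R : realType) (K : numFieldType) (S : real_part R K).
Variable X : completeNormedModType K.
Local Notation inc := (inc S).
Local Notation re := (re S).
Local Notation nrm := (@nrm R K S X).
Local Notation biorth := (@biorth R K S X).
Hypothesis HB : hahn_banach S.
Hypothesis TB : totally_bounded S.
Hypothesis infX : infinite_dimensional X.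

Lemma list_basis (xs : seq X) :
  exists n B, biorth n B /\ forall x, x \in xs -> in_span n (bv B) x.
Proof.
elim: xs => [|x xs [n [B [bi h]]]].
  by exists 0%N, (Bsys (fun=> 0) (fun _ _ => 0) (fun=> 0)); split.
have [e [f [C [fB ef [a ax]]]]] := spanning_vector HB TB infX x bi.
have [B1 [h1 h2 h3 h4]] := extend_fresh bi fB ef ltr01.
have ex y : in_span n (bv B) y -> in_span n.+1 (bv B1) y.
  move=> hy; apply: (in_span_le (leqnSn n)); apply: eq_in_span hy => i si.
  by have [] := h1 i si.
exists n.+1, B1; split=> // y; rewrite inE => /orP[/eqP ->|/h/ex//].
have -> : x = (x - a *: e) + a *: e by rewrite subrK.
apply: in_spanD; first exact: ex.
exists (fun i => if i == n then a else 0).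
rewrite big_ord_recr/= eqxx h3 rmorph1 scale1r big1 ?add0r// => i _.
by rewrite ltn_eqF// scale0r.
Qed.

(** If z lies in the span, a small multiple of a fresh vector moves it out; otherwise z itself
    serves. The old functionals are corrected to vanish on the new vector, so only the vectors of
    [B] are preserved. *)
Lemma extend_near s B z delta : biorth s B -> 0 < delta ->
  exists B', [/\ forall i, (i < s)%N -> bv B' i = bv B i, biorth s.+1 B' &
    nrm (bv B' s - z) < delta].
Proof.
move=> bi d0; have [fP fb] := bi.
have [e [f [C [[fS fC] [fe1 feb fbe] [c zc]]]]] := spanning_vector HB TB infX z bi.
have e0 : e != 0.
  by apply: contra_eq_neq fe1 => ->; rewrite (scalar_fun0 fS) eq_sym oner_eq0.
have ne : 0 < nrm e by rewrite nrm_gt0.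
pose t := if c == 0 then delta / 2 / nrm e else 0.
have tc : c + inc t != 0.
  rewrite /t; case: (eqVneq c 0) => [->|c0]; last by rewrite rmorph0 addr0.
  by rewrite add0r -(rmorph0 inc) (can_eq (incK S)) gt_eqF ?divr_gt0.
have td : `|t| * nrm e < delta.
  rewrite /t; case: eqP => _; last by rewrite normr0 mul0r.
  by rewrite gtr0_norm ?divr_gt0// divfK ?gt_eqF// ltr_pdivrMr// ltr_pMr// ltr1n.
pose w := z + inc t *: e.
have fw : f w = c + inc t.
  rewrite (scalar_funD fS) (scalar_funZ fS) fe1 mulr1; congr (_ + _).
  case: zc => a za; have -> : z = (z - c *: e) + c *: e by rewrite subrK.
  rewrite za (scalar_funD fS) (scalar_funZ fS) fe1 mulr1 (scalar_fun_sum fS) big1 ?add0r// => i _.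
  by rewrite (scalar_funZ fS) feb// mulr0.
pose g x := (c + inc t)^-1 * f x.
have gS : scalar g by move=> a x y; rewrite /g fS mulrDr mulrCA.
have gC x : re `|g x| <= re `|(c + inc t)^-1| * C * nrm x.
  by rewrite /g normrM reM// -mulrA ler_wpM2l ?re_ge0.
have gw : g w = 1 by rewrite /g fw mulVf.
have gb i : (i < s)%N -> g (bv B i) = 0 by move=> si; rewrite /g feb// mulr0.
pose f' i x := if i == s then g x else bf B i x - bf B i w * g x.
exists (Bsys (fun i => if i == s then w else bv B i) f'
  (fun i => if i == s then re `|(c + inc t)^-1| * C
   else bC B i + re `|bf B i w| * (re `|(c + inc t)^-1| * C))).
split=> [i si /=|| ]; first by rewrite ltn_eqF.
  2: by rewrite /= eqxx /w addrAC subrr add0r nrm_incZ.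
split=> [i|i j]; rewrite ltnS leq_eqVlt => /orP[/eqP ->|si]; rewrite /= /f'.
- by rewrite !eqxx; split.
- rewrite !(ltn_eqF si); have [iS iC] := fP i si; split.
    by move=> a x y; rewrite iS gS; ring.
  move=> x; apply: (le_trans (re_normD _ _ _)); rewrite mulrDl lerD//.
  by rewrite normrN normrM reM// -mulrA ler_wpM2l ?re_ge0.
- rewrite eqxx ltnS leq_eqVlt => /orP[/eqP ->|sj]; first by rewrite !eqxx gw.
  by rewrite ltn_eqF// gtn_eqF// gb.
- rewrite (ltn_eqF si) ltnS leq_eqVlt => /orP[/eqP ->|sj].
    by rewrite eqxx gw mulr1 subrr ltn_eqF.
  by rewrite (ltn_eqF sj) gb// mulr0 subr0 fb.
Qed.

Lemma extend_targets n B (tgt : nat -> (nat -> X) -> X) delta k : biorth n B -> 0 < delta ->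
  (forall i v v', (forall j, (j < n + i)%N -> v j = v' j) -> tgt i v = tgt i v') ->
  exists B', [/\ forall i, (i < n)%N -> bv B' i = bv B i, biorth (n + k) B' &
    forall i, (i < k)%N -> nrm (bv B' (n + i)%N - tgt i (bv B')) < delta].
Proof.
move=> bi d0 ext; elim: k => [|k [B1 [h1 h2 h3]]].
  by exists B; rewrite addn0; split.
have [B2 [k1 k2 k3]] := extend_near (tgt k (bv B1)) h2 d0.
exists B2; split; [|by rewrite addnS|].
  by move=> i hi; rewrite k1 ?h1// ltn_addr.
move=> i; rewrite ltnS leq_eqVlt => /orP[/eqP ->|ik].
  by rewrite (ext k (bv B2) (bv B1))//; exact: k1.
rewrite k1 ?ltn_add2l// (ext i (bv B2) (bv B1)); first exact: h3.
by move=> j hj; apply: k1; rewrite (ltn_trans hj)// ltn_add2l.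
Qed.

(* Odd indices carry the prescribed vectors u_i, even ones the free vectors
   w_i, so that T u_i = u_i + w_i + (combination of earlier basis vectors). *)
Definition interleave n k := if odd k then k./2 else (n + k./2)%N.

Lemma interleave_lt n i k : (i <= n)%N -> (k < i.*2)%N -> (interleave n k < n + i)%N.
Proof.
move=> ni ki; have hk : (k./2 < i)%N by rewrite ltn_half_double.
by rewrite /interleave; case: ifP => _; [rewrite ltn_addl|rewrite ltn_add2l].
Qed.

Lemma interleave_inj n k l : (k < n.*2)%N -> (l < n.*2)%N ->
  (interleave n k == interleave n l) = (k == l).
Proof.
move=> kn ln; apply/eqP/eqP => [|->//]; rewrite /interleave.
have hk : (k./2 < n)%N by rewrite ltn_half_double.
have hl : (l./2 < n)%N by rewrite ltn_half_double.
have Ek := odd_double_half k; have El := odd_double_half l.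
by case: (odd k) Ek; case: (odd l) El; lia.
Qed.

Lemma interleave_biorth n B : biorth (n + n) B ->
  biorth n.*2 (Bsys (bv B \o interleave n) (bf B \o interleave n) (bC B \o interleave n)).
Proof.
move=> [fP fb]; split=> [i ni|i j ni nj] /=; first by apply: fP; exact: interleave_lt.
by rewrite fb ?interleave_lt// interleave_inj.
Qed.

Lemma dense_sequence : separable X ->
  exists d : nat -> X, forall x r, 0 < r -> exists j, nrm (d j - x) < r.
Proof.
move=> [D /countable_injP[f finj] /(dense_nrm S) dD].
have [d dP] := @choice nat X (fun n x => (exists2 y, D y & f y = n) -> D x /\ f x = n)
  ltac:(move=> n; have [[y Dy fy]|h] := pselect (exists2 y, D y & f y = n);
    [by exists y|by exists 0]).
exists d => x r r0; have [y Dy yx] := dD x r r0; exists (f y).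
have [|Dd fd] := dP (f y); first by exists y.
by rewrite (finj (d (f y)) y) ?inE.
Qed.

Lemma bounded_seq (F : X -> R) (xs : seq X) : exists2 A, 0 <= A & forall x, x \in xs -> F x <= A.
Proof.
elim: xs => [|x xs [A A0 h]]; first by exists 0.
exists (Order.max A (F x)); first by rewrite le_max A0.
by move=> y; rewrite inE le_max => /orP[/eqP ->|/h ->//]; rewrite lexx orbT.
Qed.

Lemma dense_mean_irregular : separable X ->
  dense [set T : bounded_operator X |
    hypercyclic T /\ residual [set x : X | absolutely_mean_irregular re T x]].
Proof.
move=> /dense_sequence[d d_dense] O [T0 OT0] oO.
have nO : nbhs T0 O by apply: open_nbhs_nbhs; split.
have [[xs eps] /= e0 sO] : sot_nbhs T0 O := nO.
have [n [B0 [bi0 hxs]]] := list_basis xs.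
have [A A0 hA] := bounded_seq (fun x => \sum_(i < n) re `|bf B0 i x|) xs.
have re0 : 0 < re eps by rewrite -(ltr_inc S) rmorph0 reK// ltW.
(* A bounds the coefficients of each x in xs over the u_i, so errors below delta on the u_i add up
   to less than eps on x. *)
pose delta := re eps / (A + 1); have d0 : 0 < delta by rewrite divr_gt0//; lra.
(* The w_i that would make T u_i equal to T0 u_i. It is only approached, because w_i has to be
   independent of the vectors already chosen. *)
pose tgt i (v : nat -> X) := if (i < n)%N then T0 (v i) - v i -
  \sum_(l < i.*2) inc (i.*2.+1 - l)`!%:R^-1 *: v (interleave n l) else 0.
have [|B1 [h1 h2 h3]] := @extend_targets n B0 tgt delta n bi0 d0.
  move=> i v v' vv; rewrite /tgt; case: ifP => // ni.
  rewrite vv ?ltn_addr//; congr (_ - _); apply: eq_bigr => l _.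
  by rewrite vv// interleave_lt// ltnW.
have bi2 := interleave_biorth h2.
have [B [agB bi hd [C hC] good]] := taylor_basis HB TB infX d bi2.
have [T hT] := taylor_operator bi hC.
exists T; split; last first.
  split.
    exact: (hypercyclic_operator hT good hd d_dense).
  exact: (residual_mean_irregular bi hT good hd d_dense).
have bE k : (k < n.*2)%N -> bv B k = bv B1 (interleave n k).
  by move=> kn; have [] := agB k kn.
have Tu i : (i < n)%N -> nrm (T (bv B0 i) - T0 (bv B0 i)) < delta.
  move=> ni; have i2 : (i.*2.+1 < n.*2)%N by rewrite ltn_Sdouble.
  have odE : interleave n i.*2.+1 = i by rewrite /interleave /= odd_double/= uphalf_double.
  have evE : interleave n i.*2 = (n + i)%N by rewrite /interleave odd_double doubleK.
  have := h3 i ni; rewrite /tgt ni -(h1 i ni).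
  set V := \sum_(l < _) _ => h.
  have -> : bv B1 i = bv B i.*2.+1 by rewrite bE// odE.
  rewrite hT /taylor_vec big_ord_recr/= subSnn factS fact0 muln1 invr1 rmorph1 scale1r.
  rewrite (bE i.*2) ?(ltnW i2)// evE bE// odE.
  have -> : \sum_(l < i.*2) inc (i.*2.+1 - l)`!%:R^-1 *: bv B l = V.
    by apply: eq_bigr => l _; rewrite bE// (ltn_trans (ltn_ord l))// (ltnW i2).
  move: h; congr (nrm _ < _).
  by rewrite opprB opprB addrA addrC [_ + V]addrC [RHS]addrAC.
apply: sO => x xx /=.
have [c xE] := hxs x xx.
have cE i : (i < n)%N -> bf B0 i x = c i by move=> ni; rewrite xE (biorth_coef c bi0 ni).
have -> : T x - T0 x = \sum_(i < n) c i *: (T (bv B0 i) - T0 (bv B0 i)).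
  have lin (U : bounded_operator X) : U x = \sum_(i < n) c i *: U (bv B0 i).
    by rewrite xE linear_sum; apply: eq_bigr => i _; rewrite linearZ.
  by rewrite (lin T) (lin T0) -sumrB; apply: eq_bigr => i _; rewrite scalerBr.
rewrite -(reK S (normr_ge0 _)) -(reK S (ltW e0)) (ltr_inc S).
apply: (le_lt_trans (nrm_sum _ _)).
apply: (@le_lt_trans _ _ (\sum_(i < n) re `|bf B0 i x| * delta)).
  apply: ler_sum => i _; rewrite nrmZ cE// ler_wpM2l ?re_ge0//.
  by rewrite ltW// Tu.
rewrite -mulr_suml; apply: (@le_lt_trans _ _ (A * delta)).
  by rewrite ler_wpM2r ?(ltW d0)// hA.
by rewrite /delta mulrA ltr_pdivrMr ?mulrDr ?mulr1 ?[A * _]mulrC ?ltrDl//; lra.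
Qed.

End Density.

Theorem theorem1p2 (R : realType) :
  (forall X : completeNormedModType R,
      infinite_dimensional X -> separable X ->
      dense [set T : bounded_operator X |
        hypercyclic T /\
        residual [set x : X | absolutely_mean_irregular (@idfun R) T x]]) /\
  (forall X : completeNormedModType R[i],
      infinite_dimensional X -> separable X ->
      dense [set T : bounded_operator X |
        hypercyclic T /\
        residual [set x : X | absolutely_mean_irregular (@complex.Re R) T x]]).
Proof.
split=> X infX sepX.
  exact: (dense_mean_irregular (@hahn_banach_real R) (@totally_bounded_real R) infX sepX).
exact: (dense_mean_irregular (@hahn_banach_complex R) (@totally_bounded_complex R) infX sepX).
Qed.
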